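(* Let $k$ be an algebraically closed field of characteristic zero. Let $Q$ be a quiver with $n=n_1+n_2+2n_3$ vertices $s_1,\ldots,s_{n_1},t_1,\ldots,t_{n_2},u_1,u_1^\ast,\ldots,u_{n_3},u_{n_3}^\ast$, and let $\alpha\in\mathbb{N}^n$ be an admissible dimension vector. Let $$\Gamma_\alpha=\prod_{i}\mathbf{O}_{\alpha_{s_i}}\times\prod_j\mathbf{Sp}_{\alpha_{t_j}}\times\prod_k\mathbf{GL}_{\alpha_{u_k}}$$ act on the space $R(Q,\alpha)$ of representations of $Q$ of dimension $\alpha$. Then the algebra $k[R(Q,\alpha)]^{\Gamma_\alpha}$ of $\Gamma_\alpha$-invariant polynomial functions on $R(Q,\alpha)$ is generated by the functions $$(f_a)_a\longmapsto \mathrm{tr}\bigl(f_{\tilde a_p}\cdots f_{\tilde a_1}\bigr),$$ where each $\tilde a_i$ is an arrow of the associated quiver $\widetilde Q$ equal to either $a_i$ or $a_i^\ast$ for an arrow $a_i$ of $Q$, $(\tilde a_1,\ldots,\tilde a_p)$ forms an oriented closed path (oriented cycle) in $\widetilde Q$, and $f_{\tilde a_i}$ means $f_{a_i}$ or its adjoint $f_{a_i}^\ast$ according to whether $\tilde a_i$ is $a_i$ or $a_i^\ast$.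
   Context: Admissible dimension vector: $\alpha_{t_j}$ is even for all $j$ and $\alpha_{u_k}=\alpha_{u_k^\ast}$ for all $k$. $R(Q,\alpha)$ is the vector space $\bigoplus_{a\colon v\to v'}\mathrm{Hom}(k^{\alpha_v},k^{\alpha_{v'}})$, the sum being over all arrows $a$ of $Q$; its elements are written $(f_a)_a$. The group $\mathbf{GL}(\alpha)=\prod_v\mathbf{GL}_{\alpha_v}$ (product over all vertices) acts by $(g_v)_v\cdot(f_a)_a=(g_{v'}f_ag_v^{-1})_{a\colon v\to v'}$. The group $\Gamma_\alpha$ is regarded as a subgroup of $\mathbf{GL}(\alpha)$ via the standard inclusions $\mathbf{O}_{\alpha_{s_i}}\subset\mathbf{GL}_{\alpha_{s_i}}$, $\mathbf{Sp}_{\alpha_{t_j}}\subset\mathbf{GL}_{\alpha_{t_j}}$ and the inclusions $P\in\mathbf{GL}_{\alpha_{u_k}}\mapsto(P,{}^tP^{-1})\in\mathbf{GL}_{\alpha_{u_k}}\times\mathbf{GL}_{\alpha_{u_k^\ast}}$, and acts on $R(Q,\alpha)$ by restriction. Let $\sigma$ be the involution of the set of vertices fixing the $s_i$ and the $t_j$ and exchanging $u_k$ and $u_k^\ast$. The associated quiver $\widetilde Q$ is obtained from $Q$ by adding, for every arrow $a\colon v\to v'$ of $Q$, one new arrow $a^\ast\colon\sigma(v')\to\sigma(v)$. Adjoints are taken with respect to the following nondegenerate pairings between $k^{\alpha_{\sigma(v)}}$ and $k^{\alpha_v}$: the standard symmetric form (matrix $I$) on $k^{\alpha_{s_i}}$;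 the standard symplectic form (matrix $J=\begin{pmatrix} 0 & I \\ -I & 0 \end{pmatrix}$) on $k^{\alpha_{t_j}}$; and the standard pairing with matrix $I$ between $k^{\alpha_{u_k}}$ and $k^{\alpha_{u_k^\ast}}$ (so that $k^{\alpha_{u_k}}\oplus k^{\alpha_{u_k^\ast}}$ carries the form with matrix $\begin{pmatrix} 0 & I \\ I & 0 \end{pmatrix}$). Explicitly, writing $\Phi_v=I$ if $v$ is one of the $s_i,u_k,u_k^\ast$ and $\Phi_v=J$ if $v$ is one of the $t_j$, the adjoint of $f_a\colon k^{\alpha_v}\to k^{\alpha_{v'}}$ is $f_a^\ast=\Phi_v^{-1}\,{}^tf_a\,\Phi_{v'}\colon k^{\alpha_{\sigma(v')}}\to k^{\alpha_{\sigma(v)}}$. *)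

(* Defs.v *)
From HB Require Import structures.
From mathcomp Require Import all_boot all_order all_algebra.
From mathcomp Require Import mpoly.

Set Implicit Arguments.
Unset Strict Implicit.
Unset Printing Implicit Defensive.

Import GRing.Theory.
Local Open Scope ring_scope.

Record quiver (V : Type) : Type := Quiver {
  arrow : finType;
  src : arrow -> V;
  tgt : arrow -> V
}.

(* Oriented paths of length at least 1, from the first index to the second:
   [path_rcons a c] runs through [c] and then through the arrow [a]. *)
Inductive qpath (V : Type) (Q : quiver V) : V -> V -> Type :=
| path_arrow (a : arrow Q) : qpath Q (src a) (tgt a)
| path_rcons (v : V) (a : arrow Q) (c : qpath Q v (src a)) : qpath Q v (tgt a).

Definition qrep (k : fieldType) (V : Type) (Q : quiver V) (alpha : V -> nat) :
    Type :=
  forall a : arrow Q, 'M[k]_(alpha (tgt a), alpha (src a)).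

(* The product f_{a_p} *m ... *m f_{a_1} along the path (a_1, ..., a_p). *)
Fixpoint path_mx (k : fieldType) (V : Type) (Q : quiver V) (alpha : V -> nat)
    (f : qrep k Q alpha) (v w : V) (c : qpath Q v w) {struct c} :
    'M[k]_(alpha w, alpha v) :=
  match c in qpath _ v0 w0 return 'M[k]_(alpha w0, alpha v0) with
  | path_arrow a => f a
  | path_rcons _ a c' => f a *m path_mx f c'
  end.

(* An element of GL(alpha) is a family [g] with [g v \in unitmx] for all [v]. *)
Definition qact (k : fieldType) (V : Type) (Q : quiver V) (alpha : V -> nat)
    (g : forall v : V, 'M[k]_(alpha v)) (f : qrep k Q alpha) : qrep k Q alpha :=
  fun a => g (tgt a) *m f a *m invmx (g (src a)).

Inductive vertex (n1 n2 n3 : nat) : Type :=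
| vs of 'I_n1
| vt of 'I_n2
| vu of 'I_n3
| vustar of 'I_n3.

Arguments vs {n1 n2 n3} i.
Arguments vt {n1 n2 n3} j.
Arguments vu {n1 n2 n3} l.
Arguments vustar {n1 n2 n3} l.

Definition sigma (n1 n2 n3 : nat) (v : vertex n1 n2 n3) : vertex n1 n2 n3 :=
  match v with
  | vs i => vs i
  | vt j => vt j
  | vu l => vustar l
  | vustar l => vu l
  end.

(* [inl a] is the arrow a itself, and [inr a] is a^*. *)
Definition assoc_quiver (n1 n2 n3 : nat) (Q : quiver (vertex n1 n2 n3)) :
    quiver (vertex n1 n2 n3) :=
  @Quiver _ (arrow Q + arrow Q)%type
    (fun b => match b with inl a => src a | inr a => sigma (tgt a) end)
    (fun b => match b with inl a => tgt a | inr a => sigma (src a) end).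

Definition admissible (n1 n2 n3 : nat) (alpha : vertex n1 n2 n3 -> nat) : Prop :=
  (forall j : 'I_n2, ~~ odd (alpha (vt j))) /\
  (forall l : 'I_n3, alpha (vu l) = alpha (vustar l)).

Lemma admissible_sigma (n1 n2 n3 : nat) (alpha : vertex n1 n2 n3 -> nat) :
  admissible alpha -> forall v, alpha v = alpha (sigma v).
Proof. by case=> _ H [i|j|l|l] /=. Qed.

(* Entrywise description of [[0, I], [-I, 0]], only meaningful for m even; it
   makes J available on k^m when m is known to be even only propositionally. *)
Definition Jmx (k : fieldType) (m : nat) : 'M[k]_m :=
  \matrix_(i, j) ((j == i + m./2 :> nat)%N%:R - (i == j + m./2 :> nat)%N%:R).

Lemma JmxE (k : fieldType) (h : nat) :
  Jmx k (h + h) = block_mx 0 1%:M (- 1%:M) 0.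
Proof.
have half_h : (h + h)./2 = h by rewrite addnn doubleK.
apply/matrixP=> i j; rewrite mxE half_h.
case: (split_ordP i) => i' ->; case: (split_ordP j) => j' ->.
- rewrite block_mxEul mxE /= !ltn_eqF ?subrr //; last first.
    by rewrite ltn_addl.
  by rewrite ltn_addl.
- rewrite block_mxEur mxE /= (@ltn_eqF i' (h + j' + h)) ?subr0.
    by rewrite addnC eqn_add2r eq_sym.
  by rewrite ltn_addl.
- rewrite block_mxEdl !mxE /= (@ltn_eqF j' (h + i' + h)) ?sub0r.
    by rewrite addnC eqn_add2r.
  by rewrite ltn_addl.
- rewrite block_mxEdr mxE /= (@ltn_eqF (h + j') (h + i' + h)).
    rewrite (@ltn_eqF (h + i') (h + j' + h)) ?subrr //.
    by rewrite -addnA ltn_add2l ltn_addl.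
  by rewrite -addnA ltn_add2l ltn_addl.
Qed.

Definition form_mx (k : fieldType) (n1 n2 n3 : nat)
    (alpha : vertex n1 n2 n3 -> nat) (v : vertex n1 n2 n3) : 'M[k]_(alpha v) :=
  match v with
  | vt j => Jmx k (alpha (vt j))
  | _ => 1%:M
  end.

(* The cast identifies k^(alpha v) with k^(alpha (sigma v)); it has to be
   explicit because the dimensions agree only by admissibility. *)
Definition adjoint (k : fieldType) (n1 n2 n3 : nat)
    (alpha : vertex n1 n2 n3 -> nat) (Halpha : admissible alpha)
    (v v' : vertex n1 n2 n3) (f : 'M[k]_(alpha v', alpha v)) :
    'M[k]_(alpha (sigma v), alpha (sigma v')) :=
  castmx (admissible_sigma Halpha v, admissible_sigma Halpha v')
    (invmx (form_mx k alpha v) *m f^T *m form_mx k alpha v').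

Definition assoc_rep (k : fieldType) (n1 n2 n3 : nat)
    (Q : quiver (vertex n1 n2 n3)) (alpha : vertex n1 n2 n3 -> nat)
    (Halpha : admissible alpha) (f : qrep k Q alpha) :
    qrep k (assoc_quiver Q) alpha :=
  fun b => match b with
           | inl a => f a
           | inr a => adjoint Halpha (f a)
           end.

Definition orthogonal_mx (k : fieldType) (m : nat) (P : 'M[k]_m) : Prop :=
  P^T *m P = 1%:M.

Definition symplectic_mx (k : fieldType) (m : nat) (P : 'M[k]_m) : Prop :=
  P^T *m Jmx k m *m P = Jmx k m.

(* The image of O x Sp x GL in GL(alpha); the component at u_l^* is determined
   by the one at u_l, up to the cast given by admissibility. *)
Definition in_Gamma (k : fieldType) (n1 n2 n3 : nat)
    (alpha : vertex n1 n2 n3 -> nat) (Halpha : admissible alpha)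
    (g : forall v : vertex n1 n2 n3, 'M[k]_(alpha v)) : Prop :=
  [/\ forall i : 'I_n1, orthogonal_mx (g (vs i)),
      forall j : 'I_n2, symplectic_mx (g (vt j)),
      forall l : 'I_n3, g (vu l) \in unitmx
    & forall l : 'I_n3,
        g (vustar l) =
        castmx (Halpha.2 l, Halpha.2 l) (invmx (g (vu l)))^T].

(* [F] belongs to the k-subalgebra (with unit) generated by the set [S] in the
   algebra of all functions X -> k: it is a polynomial in finitely many elements
   of [S]. *)
Definition in_subalg (k : fieldType) (X : Type) (S : (X -> k) -> Prop)
    (F : X -> k) : Prop :=
  exists (m : nat) (G : 'I_m -> X -> k) (p : {mpoly k[m]}),
    (forall i, S (G i)) /\ (forall x, F x = p.@[fun i => G i x]).

Definition coordinate_function (k : fieldType) (V : Type) (Q : quiver V)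
    (alpha : V -> nat) (G : qrep k Q alpha -> k) : Prop :=
  exists (a : arrow Q) (i : 'I_(alpha (tgt a))) (j : 'I_(alpha (src a))),
    forall f, G f = f a i j.

Definition polynomial_function (k : fieldType) (V : Type) (Q : quiver V)
    (alpha : V -> nat) (F : qrep k Q alpha -> k) : Prop :=
  in_subalg (@coordinate_function k V Q alpha) F.

Definition Gamma_invariant (k : fieldType) (n1 n2 n3 : nat)
    (Q : quiver (vertex n1 n2 n3)) (alpha : vertex n1 n2 n3 -> nat)
    (Halpha : admissible alpha) (F : qrep k Q alpha -> k) : Prop :=
  forall g : (forall v : vertex n1 n2 n3, 'M[k]_(alpha v)),
    in_Gamma Halpha g -> forall f, F (qact g f) = F f.

Definition trace_function (k : fieldType) (n1 n2 n3 : nat)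
    (Q : quiver (vertex n1 n2 n3)) (alpha : vertex n1 n2 n3 -> nat)
    (Halpha : admissible alpha) (G : qrep k Q alpha -> k) : Prop :=
  exists (v : vertex n1 n2 n3) (c : qpath (assoc_quiver Q) v v),
    forall f, G f = \tr (path_mx (assoc_rep Halpha f) c).

(* Main.v *)
Require Import Defs.
From HB Require Import structures.
From mathcomp Require Import all_boot all_order all_algebra perm.
From mathcomp Require Import mpoly.
From mathcomp Require Import ring zify.

Set Implicit Arguments.
Unset Strict Implicit.
Unset Printing Implicit Defensive.

Import GRing.Theory.
Local Open Scope ring_scope.

(** The easy half is formal: entries of a product along a path are polynomials
in the entries of [f], and the adjoint is equivariant for the group, so a
trace along a closed path is an invariant polynomial.

For the converse, pass to tensors. Let V be the direct sum of all the spaces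
k^(alpha v); its standard basis vectors are called letters, and a tensor on
V^(x)I is a function on words, that is, on maps from the set I of slots to
the letters. The forms at the vertices pair each letter [a] with one dual letter
[dual a] up to a sign [sgn a]. A matrix [f a] becomes a bivector, an element of
V (x) V, and a homogeneous invariant polynomial of degree d becomes, by
[polarization], a family of invariant tensors with 2 d slots, one for every word
of d arrows ([coef_tensor_invariant]). Invariance of tensors under one-parameter
families of elements of the group, written in Cayley form so that they are
rational in the parameter, gives invariance under the Lie algebra; reflections
give a parity condition at the orthogonal vertices
([inv_tensor_of_preserves_form]).

The core is [inv_tensor_decomposition]: for S nonempty, an invariant tensor is a
sum of tensors obtained from invariant tensors in two slots less by inserting the
form in the two missing slots. Take the Casimir operator Z of the product of the
gl(alpha v), corrected by a diagonal term. On invariant tensors the Lie algebra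
relation rewrites Z as a sum over pairs of slots of contractions followed by
insertions ([casimir_contr]). So it is enough that Z maps the space of
invariant tensors onto itself, and since this space is finite-dimensional and
stable under Z, that Z is injective there. If Z psi = 0, let w be a word in the
support of psi whose letter multiplicities have the largest sum of squares (up to
the correction), among all such psi. Replacing a letter of w by another letter of
its block that is at least as frequent increases that quantity, so the
corresponding raising operators vanish at w, and Z multiplies the coefficient
at w by an explicit integer. This integer is positive because orthogonal letters
occur an even number of times, hence nonzero in characteristic 0
([casimir_kernel]).

Finally, evaluate an invariant tensor on bivectors attached to paths of the
associated quiver and induct on the number of bivectors ([ev_in_subalg]). Inserting
the form in two slots of one bivector closes up its path and
produces a trace; inserting it in slots of two bivectors glues two paths, one of
them possibly reversed, which is where adjoints enter ([bivector_glue],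
[bivector_flip], [bivector_close]). *)

(** * Auxiliary facts *)

Lemma ffun_neq (I : finType) (T : eqType) (f g : {ffun I -> T}) :
  f != g -> exists x, f x != g x.
Proof.
move=> fg; apply/existsP; apply: contraNT fg; rewrite negb_exists => /forallP e.
by apply/eqP/ffunP => x; apply/eqP; have := e x; rewrite negbK.
Qed.

Lemma poly_natroots (k : fieldType) (p : {poly k}) : [pchar k] =i pred0 ->
  (forall n : nat, p.[n%:R] = 0) -> p = 0.
Proof.
move=> /pcharf0P char0 p0; apply/eqP; apply: contraT => pN0.
have := max_poly_roots (rs := [seq n%:R | n <- iota 0 (size p)]) pN0.
rewrite size_map size_iota ltnn; apply.
  by apply/allP => _ /mapP[n _ ->]; rewrite /root p0.
rewrite map_inj_uniq ?iota_uniq // => m n /eqP.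
wlog mn : m n / (m <= n)%N => [H|].
  by case: (leqP m n) => [/H//|/ltnW/H{}H]; rewrite eq_sym => /H.
rewrite eq_sym -subr_eq0 -natrB // char0 => /eqP ?; lia.
Qed.

Lemma coef1_prod (k : fieldType) (J : finType) (h : J -> {poly k}) :
  (\prod_j h j)`_1 = \sum_i (h i)`_1 * \prod_(j | j != i) (h j)`_0.
Proof.
have gen (r : seq J) : uniq r ->
    (\prod_(j <- r) h j)`_1 = \sum_(i <- r) (h i)`_1 * \prod_(j <- r | j != i)
      (h j)`_0.
  elim: r => [|a r IH] /=; first by rewrite !big_nil coef1.
  case/andP => ar ur; rewrite !big_cons coefM big_ord_recr big_ord1 /= subnn subn0
    IH //.
  rewrite eqxx /= addrC coef0_prod; congr (_ * _ + _).
    by rewrite [RHS]big_mkcond; apply: eq_big_seq => i ir; rewrite ifT //;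
      apply: contraNneq ar => <-.
  rewrite mulr_sumr; apply: eq_big_seq => i ir.
  by rewrite big_cons ifT 1?mulrCA //; apply: contraNneq ar => ->.
by rewrite gen ?index_enum_uniq.
Qed.

(** * Words, and the operators of the general linear Lie algebras *)

(** A basis [L] of a space that is split into blocks indexed by [V], with the form
whose only nonzero values on basis vectors are [sgn a], at [a] and [dual a]. The
last four fields say that each block is of one of three kinds: orthogonal, with
every letter dual to itself; symplectic, with dual letters distinct, of opposite
signs and in the same block; or isotropic, with the dual letters in another
block. *)
Record paired_basis (k : fieldType) (V L : finType) := PairedBasis {
  vtx : L -> V;
  dual : L -> L;
  sgn : L -> k;
  dualK : involutive dual;
  sgnK : forall a, sgn a * sgn a = 1;
  vtx_dual : forall a b, vtx a = vtx b -> vtx (dual a) = vtx (dual b);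
  sgn_dual : forall a b, vtx a = vtx b ->
    sgn a * sgn (dual a) = sgn b * sgn (dual b);
  dual_fix : forall a b, vtx a = vtx b -> (dual a == a) = (dual b == b);
  dual_skew : forall a, vtx (dual a) = vtx a -> dual a != a ->
    sgn a * sgn (dual a) = -1
}.

Section Words.

Variables (k : fieldType) (V L I : finType) (B : paired_basis k V L).
Implicit Types (S : {set I}) (w : {ffun I -> L}) (phi : {ffun I -> L} -> k).

(* Tensors are given by their coefficients, as functions on words. *)
Definition upd w i a : {ffun I -> L} := [ffun j => if j == i then a else w j].

Lemma upd_same w i a : upd w i a i = a.
Proof. by rewrite ffunE eqxx. Qed.

Lemma upd_other w i a j : j != i -> upd w i a j = w j.
Proof. by rewrite ffunE => /negbTE ->. Qed.

Lemma upd_upd w i a b : upd (upd w i a) i b = upd w i b.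
Proof. by apply/ffunP => j; rewrite !ffunE; case: eqP. Qed.

Lemma upd_id w i : upd w i (w i) = w.
Proof. by apply/ffunP => j; rewrite !ffunE; case: eqP => // ->. Qed.

Lemma updC w i a j b : i != j -> upd (upd w i a) j b = upd (upd w j b) i a.
Proof.
move=> ij; apply/ffunP => l; rewrite !ffunE.
case: (eqVneq l j) => [->|] //; by rewrite eq_sym (negbTE ij).
Qed.

(** The elementary matrix that sends [b] to [a] and the other letters to 0, acting
as a derivation on the slots of [S]; [phi] lists the coefficients of a tensor. *)
Definition der S a b phi w : k := \sum_(i in S | w i == a) phi (upd w i b).

(** The part of a product of two such operators that acts on two distinct slots. *)
Definition der2 S a b c d phi w : k :=
  \sum_(i in S | w i == a) \sum_(j in S | (j != i) && (w j == c))
     phi (upd (upd w i b) j d).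

Lemma eq_der S a b phi psi w : phi =1 psi -> der S a b phi w = der S a b psi w.
Proof. by move=> e; apply: eq_bigr => i _; rewrite e. Qed.

Lemma der_der S a b c d phi w :
  der S a b (der S c d phi)
    w = (b == c)%:R * der S a d phi w + der2 S a b c d phi w.
Proof.
rewrite /der /der2 mulr_sumr -big_split /=; apply: eq_bigr => i /andP[iS /eqP wi].
rewrite (bigID (pred1 i)) /=; congr (_ + _).
  rewrite (eq_bigl (fun j => (j == i) && (b == c))); last first.
    move=> j; case: (eqVneq j i) => [->|]; last by rewrite !andbF.
    by rewrite upd_same iS /= andbT.
  rewrite big_mkcondr big_pred1_eq upd_upd.
  by case: (b == c); rewrite ?mul1r ?mul0r.
apply: eq_bigl => j; case: (eqVneq j i) => [->|ji]; first by rewrite !andbF.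
by rewrite upd_other // andbT.
Qed.

Lemma der2C S a b c d phi w : der2 S a b c d phi w = der2 S c d a b phi w.
Proof.
rewrite /der2 (exchange_big_dep (fun j => (j \in S) && (w j == c))) /=; last first.
  by move=> i j _ /and3P[-> _ ->].
apply: eq_bigr => j /andP[jS wj]; rewrite jS wj.
rewrite (eq_bigl (fun i => (i \in S) && ((i != j) && (w i == a)))); last first.
  by move=> i; rewrite /= andbT [j == i]eq_sym andbAC andbA.
by apply: eq_bigr => i /and3P[_ ij _]; rewrite updC.
Qed.

(** The relations of gl: the two-slot parts of both products agree, only the
products inside one slot differ. *)
Lemma der_comm S a b c d phi w :
  der S a b (der S c d phi) w = der S c d (der S a b phi) w
    + (b == c)%:R * der S a d phi w - (d == a)%:R * der S c b phi w.
Proof. by rewrite !der_der (der2C S c); ring. Qed.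

Definition occ S w a : nat := \sum_(i in S) (w i == a).

Lemma der_diag S a phi w : der S a a phi w = (occ S w a)%:R * phi w.
Proof.
rewrite /der (eq_bigr (fun=> phi w)); last first.
  by move=> i /andP[_ /eqP <-]; rewrite upd_id.
by rewrite big_mkcondr /occ natr_sum mulr_suml; apply: eq_bigr => i _; case: eqP;
  rewrite ?mul1r ?mul0r.
Qed.

Lemma occ_upd S w i a c : i \in S ->
  (occ S (upd w i a) c + (w i == c) = occ S w c + (a == c))%N.
Proof.
move=> iS; rewrite /occ !(bigD1 i iS) /= upd_same.
rewrite (eq_bigr (fun j => nat_of_bool (w j == c))); last first.
  by move=> j /andP[_ ji]; rewrite upd_other.
by rewrite addnAC [RHS]addnC addnA.
Qed.

(** The scalar by which the terms inside one slot act on the letter [a], when the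
Casimir operator of gl is rewritten with the adjoint operators: 1 at an orthogonal
block, -1 at a symplectic one and 0 at an isotropic one. *)
Definition dual_sign (a : L) : k :=
  if vtx B (dual B a) == vtx B a then sgn B a * sgn B (dual B a) else 0.

(** The subtracted diagonal term is chosen to cancel those one-slot terms, so that
[casimir_contr] involves contractions only. *)
Definition casimir S phi w : k :=
  \sum_a \sum_(b | vtx B b == vtx B a) der S a b (der S b a phi) w
  - \sum_a dual_sign a * der S a a phi w.

Lemma dual_sign_vtx a b : vtx B a = vtx B b -> dual_sign a = dual_sign b.
Proof.
by move=> ab; rewrite /dual_sign (vtx_dual ab) ab (sgn_dual ab).
Qed.

Lemma der_sum S a b (J : Type) (r : seq J) (P : pred J)
    (F : J -> {ffun I -> L} -> k) w :
  der S a b (fun w => \sum_(j <- r | P j) F j w) w = \sum_(j <- r | P j)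
    der S a b (F j) w.
Proof. by rewrite /der exchange_big. Qed.

Lemma derZ S a b (c : k) phi w : der S a b (fun w =>
    c * phi w) w = c * der S a b phi w.
Proof. by rewrite /der mulr_sumr. Qed.

Lemma derD S a b phi psi w :
  der S a b (fun w => phi w + psi w) w = der S a b phi w + der S a b psi w.
Proof. by rewrite /der big_split. Qed.

Lemma derB S a b phi psi w :
  der S a b (fun w => phi w - psi w) w = der S a b phi w - der S a b psi w.
Proof. by rewrite /der sumrB. Qed.

(** The Casimir operator is central, and the diagonal correction is a scalar on
each block. *)
Lemma casimir_der S c d phi w : vtx B c = vtx B d ->
  casimir S (der S c d phi) w = der S c d (casimir S phi) w.
Proof.
move=> cd; rewrite /casimir derB !der_sum; congr (_ - _); last first.
  under [RHS]eq_bigr do rewrite derZ.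
  apply/eqP; rewrite -subr_eq0 -sumrB; apply/eqP.
  under eq_bigr => a _ do rewrite (der_comm S a a c d).
  rewrite (eq_bigr (fun a => (a == c)%:R * (dual_sign a * der S a d phi w)
     - (d == a)%:R * (dual_sign a * der S c a phi w))); last by move=> a _; ring.
  rewrite sumrB (bigD1 c) //= eqxx big1 ?addr0; last by move=> a /negbTE->;
    rewrite mul0r.
  rewrite (bigD1 d) //= eqxx big1 ?addr0; last by move=> a;
    rewrite eq_sym => /negbTE->; rewrite mul0r.
  by rewrite (dual_sign_vtx cd) subrr.
apply/eqP; rewrite -subr_eq0 -sumrB; apply/eqP.
under eq_bigr do rewrite der_sum -sumrB.
have key a b : der S a b (der S b a (der S c d phi))
  w - der S c d (der S a b (der S b a phi)) w
  = (a == c)%:R * der S a b (der S b d phi)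
    w - (d == b)%:R * der S a b (der S c a phi) w
    + (b == c)%:R * der S a d (der S b a phi)
      w - (d == a)%:R * der S c b (der S b a phi) w.
  rewrite (eq_der S a b w (fun w => der_comm S b a c d phi w)) derB derD !derZ.
  by rewrite (der_comm S a b c d (der S b a phi)); ring.
under eq_bigr do under eq_bigr do rewrite key.
have pickl (x : L) (P : rel L) (F : L -> L -> k) :
    \sum_a \sum_(b | P a b) (a == x)%:R * F a b = \sum_(b | P x b) F x b.
  rewrite (bigD1 x) //= [X in _ + X]big1 ?addr0 => [|a /negbTE ax].
    by apply: eq_bigr => b _; rewrite eqxx mul1r.
  by rewrite big1 // => b _; rewrite ax mul0r.
have pickr (x : L) (P : rel L) (F : L -> L -> k) :
    \sum_a \sum_(b | P a b) (b == x)%:R * F a b = \sum_(a | P a x) F a x.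
  rewrite (exchange_big_dep predT) //= -(pickl x (fun b a => P a b)) //.
under eq_bigr do rewrite !(sumrB, big_split) /=.
rewrite !(sumrB, big_split) /=.
under [X in _ - X + _ - _]eq_bigr do under eq_bigr do rewrite eq_sym.
under [X in _ - X]eq_bigr do under eq_bigr do rewrite eq_sym.
rewrite !pickl !pickr cd.
under [X in _ - X + _ - _]eq_bigl do rewrite eq_sym.
under [X in _ + X - _]eq_bigl do rewrite eq_sym.
ring.
Qed.

Lemma eq_casimir S phi psi w : phi =1 psi -> casimir S phi w = casimir S psi w.
Proof.
move=> e; rewrite /casimir; congr (_ - _); apply: eq_bigr => a _;
  last by rewrite (eq_der _ _ _ _ e).
by apply: eq_bigr => b _; apply: eq_der => v; apply: eq_der.
Qed.

(** * The kernel of the Casimir operator *)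

(** The sum of the squared multiplicities, minus the number of orthogonal letters.
The truncated subtraction is harmless since it is multiplied by [occ S w a]. *)
Definition energy S w : nat :=
  \sum_a occ S w a * (occ S w a - (dual B a == a)).

(** Changing one [b] into an [a] with [occ b <= occ a] raises the sum of squares
by [2 (occ a - occ b) + 2]; the number of orthogonal letters is unchanged because
[a] and [b] lie in the same block. *)
Lemma energy_upd S w i a : i \in S -> a != w i -> vtx B a = vtx B (w i) ->
  (occ S w (w i) <= occ S w a)%N -> (energy S w < energy S (upd w i a))%N.
Proof.
move=> iS ai va; have M := occ_upd w a _ iS; set b := w i in ai va M *.
have ma : occ S (upd w i a) a = (occ S w a).+1.
  by have := M a; rewrite eqxx eq_sym (negbTE ai) addn0 addn1.
have mb : (occ S (upd w i a) b).+1 = occ S w b.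
  by have := M b; rewrite eqxx (negbTE ai) addn0 addn1.
have mc c : c != a -> c != b -> occ S (upd w i a) c = occ S w c.
  by move=> ca cb; have := M c;
    rewrite [a == c]eq_sym [b == c]eq_sym (negbTE ca) (negbTE cb) !addn0.
rewrite /energy !(bigD1 a isT) /= !(bigD1 (P := fun c =>
  c != a) b) ?[b == a]eq_sym //=.
under [X in (_ < _ + (_ + X))%N]eq_bigr => c /andP[ca cb] do rewrite mc //.
rewrite ma -mb (dual_fix va).
set X := occ S (upd w i a) b; set Y := occ S w a; set r := \sum_(c | _) _.
case: (dual B b == b) => /=; nia.
Qed.

(** The eigenvalue met in [casimir_kernel]: the diagonal terms contribute at least
the energy, and all the other terms are natural numbers. *)
Lemma casimir_coef (m : L -> nat) (x : k) :
  [pchar k] =i pred0 -> (0 < \sum_a m a * (m a - (dual B a == a)))%N ->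
  \sum_a \sum_(b | vtx B b == vtx B a)
    (if a == b then m a * m a else m a - m b)%N%:R * x
    - \sum_a dual_sign a * ((m a)%:R * x) = 0 -> x = 0.
Proof.
move=> /pcharf0P char0 Qgt0.
have dual_signE a : dual_sign a = (dual B a == a)%:R - ((dual B a != a)
  && (vtx B (dual B a) == vtx B a))%:R.
  rewrite /dual_sign; case: (eqVneq (dual B a) a) => [->|da] /=;
    first by rewrite eqxx sgnK subr0.
  by case: eqP => [va|_]; rewrite ?subrr // dual_skew // sub0r.
rewrite (eq_bigr (fun a =>
  ((m a * m a)%N%:R + (\sum_(b | (vtx B b == vtx B a) && (b != a))
  (m a - m b))%N%:R) * x)); last first.
  move=> a _; rewrite (bigD1 a) //= eqxx mulrDl; congr (_ + _).
  by rewrite natr_sum mulr_suml; apply: eq_bigr => b /andP[_];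
    rewrite eq_sym => /negbTE ->.
rewrite -mulr_suml.
under [X in _ - X]eq_bigr do rewrite mulrA.
rewrite -mulr_suml -mulrBl -sumrB => /eqP; rewrite mulf_eq0 => /orP[|/eqP //].
rewrite (eq_bigr (fun a => ((m a * (m a - (dual B a == a)))
   + (\sum_(b | (vtx B b == vtx B a) && (b != a)) (m a - m b))
   + ((dual B a != a) && (vtx B (dual B a) == vtx B a)) * m a)%N%:R)); last first.
  move=> a _; rewrite dual_signE !natrD !natrM mulrBl.
  have -> : (m a)%:R * (m a - (dual B a == a))%N%:R = (m a)%:R * (m a)%:R - (dual B
    a == a)%:R * (m a)%:R :> k.
    case: (m a) => [|n]; first by rewrite !(mul0r, mulr0) subr0.
    by case: (dual B a == a) => /=;
      rewrite ?subn0 ?subn1 /= ?mul0r ?subr0 // -{2}natr1; ring.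
  ring.
rewrite -natr_sum char0 !big_split /= -addnA addn_eq0 => /andP[/eqP Q0 _].
by rewrite Q0 in Qgt0.
Qed.

(** Induction downwards on the energy: on a word of positive energy, all raising
operators vanish by induction, as they commute with the Casimir operator, and the
commutation relations then evaluate the Casimir operator at that word. *)
Lemma casimir_kernel S psi : [pchar k] =i pred0 ->
  (forall w, casimir S psi w = 0) -> forall w, (0 < energy S w)%N -> psi w = 0.
Proof.
move=> char0 Zpsi w; pose M := \max_w energy S w.
have [n] := ubnP (M - energy S w)%N; elim: n => // n IH in psi Zpsi w *.
rewrite ltnS => Mw Qw.
have raise a b : vtx B a = vtx B b -> a != b -> (occ S w b <= occ S w a)%N ->
    der S b a (der S a b psi) w = 0.
  move=> vab ab mab; apply: big1 => i /andP[iS /eqP wi].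
  have lt : (energy S w < energy S (upd w i a))%N by apply: energy_upd => //;
    rewrite wi.
  apply: IH; last exact: leq_trans lt.
    move=> v; rewrite (casimir_der _ _ _ vab) /der big1 // => j _; exact: Zpsi.
  apply: leq_trans Mw; apply: ltn_sub2l => //.
  by apply: leq_trans lt _; apply: leq_bigmax.
apply: (casimir_coef char0 Qw).
rewrite -[RHS](Zpsi w) /casimir; congr (_ - _); last by apply: eq_bigr => a _;
  rewrite der_diag.
apply: eq_bigr => a _; apply: eq_bigr => b /eqP vab.
have [<-|ab] := eqVneq a b; first by rewrite !der_diag natrM mulrA.
have [mab|mab] := leqP (occ S w b) (occ S w a); last first.
  rewrite raise // 1?eq_sym //; last exact: ltnW.
  by rewrite (eqP (ltnW mab : (_ - _ == 0)%N)) mul0r.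
rewrite der_comm raise // !eqxx !der_diag add0r !mul1r -mulrBl natrB //.
Qed.

(** * Invariant tensors and their contractions *)

(** Invariance under the Lie algebra of the group, together with invariance under
the reflections in the orthogonal letters. The second condition is what separates
the orthogonal group from the special orthogonal one; without it determinants
would be invariant. *)
Definition inv_tensor S phi : Prop :=
  (forall a b w, vtx B a = vtx B b ->
     der S b a phi w = sgn B a * sgn B b * der S (dual B a) (dual B b) phi w) /\
  (forall a w, dual B a = a -> odd (occ S w a) -> phi w = 0).

Definition contr i j (v : V) phi w : k :=
  \sum_(b | vtx B b == v) sgn B b * phi (upd (upd w i b) j (dual B b)).

(** The coefficients of the form of the block [v], inserted in the slots [i] and [j]. *)
Definition pair_coef i j (v : V) w : k :=
  (vtx B (w i) == v)%:R * (w j == dual B (w i))%:R * sgn B (w i).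

Lemma der_lin S a b (c : k) phi psi w :
  der S a b (fun w => c * phi w + psi w) w = c * der S a b phi w + der S a b psi w.
Proof. by rewrite derD derZ. Qed.

Lemma casimir_lin S (c : k) phi psi w :
  casimir S (fun w => c * phi w + psi w) w = c * casimir S phi w + casimir S psi w.
Proof.
rewrite /casimir.
under [X in X - _ = _]eq_bigr => a _.
  under eq_bigr => b _ do
    rewrite (eq_der S a b w (der_lin S b a c phi psi)) der_lin.
  rewrite big_split -mulr_sumr /=.
over.
under [X in _ - X = _]eq_bigr do rewrite der_lin mulrDr mulrCA.
by rewrite !big_split -!mulr_sumr /=; ring.
Qed.

Lemma inv_tensor_casimir S phi : inv_tensor S phi -> inv_tensor S (casimir S phi).
Proof.
move=> [lie par]; split=> [a b w vab|a w daa odda].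
  rewrite -!casimir_der ?(vtx_dual vab) // (eq_casimir _ _ (fun w =>
    lie a b w vab)).
  have z v : sgn B a * sgn B b * der S (dual B a) (dual B b) phi v
           = sgn B a * sgn B b * der S (dual B a) (dual B b)
             phi v + 0 by rewrite addr0.
  rewrite (eq_casimir _ _ z) casimir_lin [X in _ + X](_ : _ = 0) ?addr0 //.
  rewrite /casimir !big1 ?subrr // => c _; first by rewrite /der big1 ?mulr0.
  by rewrite big1 // => d _; rewrite /der big1 // => i _; rewrite big1.
rewrite /casimir [X in _ - X]big1 ?subr0 => [|b _];
  last by rewrite der_diag (par a) // !mulr0.
rewrite big1 // => b _; rewrite big1 // => c vbc.
rewrite /der big1 // => i /andP[iS /eqP wi]; rewrite big1 // => j /andP[jS /eqP wj].
apply: (par a) => //.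
have M1 := occ_upd w c a iS; have M2 := occ_upd (upd w i c) b a jS.
rewrite wi in M1; rewrite wj in M2.
suff -> : occ S (upd (upd w i c) j b) a = occ S w a by [].
lia.
Qed.

(** Use the Lie algebra relation on the inner operator of each product
[der a b (der b a phi)]; the two-slot part of the result is a contraction followed
by an insertion, summed over the letters [a] and [b] of a block. *)
Lemma casimir_contr S phi w : inv_tensor S phi ->
  casimir S phi w = \sum_(i in S) \sum_(j in S | j != i)
    \sum_v pair_coef i j v w * contr i j v phi w.
Proof.
move=> [lie _]; rewrite /casimir.
under eq_bigr => a _.
  under eq_bigr => b /eqP vba.
    rewrite (eq_der S a b w (fun w => lie a b w (esym vba))) derZ der_der mulrDr.
  over.
  rewrite big_split /=.
over.
rewrite big_split /=.
have -> : \sum_a \sum_(b | vtx B b == vtx B a) sgn B a * sgn B b *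
    ((b == dual B a)%:R * der S a (dual B b) phi w)
      = \sum_a dual_sign a * der S a a phi w.
  apply: eq_bigr => a _; rewrite /dual_sign; case: ifP => va.
    rewrite (bigD1 (dual B a)) //= eqxx mul1r dualK big1 ?addr0 // =>
      b /andP[_ /negbTE->].
    by rewrite mul0r mulr0.
  rewrite mul0r big1 // => b vb; case: eqP => [bE|]; last by rewrite mul0r mulr0.
  by rewrite bE va in vb.
rewrite addrAC subrr add0r /der2.
rewrite [RHS](partition_big w predT) //=; apply: eq_bigr => a _.
under eq_bigr do rewrite mulr_sumr.
rewrite exchange_big /=; apply: eq_bigr => i /andP[_ /eqP wi].
under eq_bigr do rewrite mulr_sumr.
rewrite exchange_big /=.
rewrite [RHS](bigID (fun j => w j == dual B a)) /= [X in _ = _ + X]big1 ?addr0;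
  last first.
  move=> j /andP[_ wj]; rewrite big1 // => v _; rewrite /pair_coef wi (negbTE wj).
  by rewrite mulr0 !mul0r.
apply: eq_big => [j|j /andP[_ /andP[_ wj]]]; first by rewrite andbA.
rewrite (bigD1 (vtx B a)) //= [X in _ = _ + X]big1 ?addr0 => [|v va]; last first.
  by rewrite /pair_coef wi eq_sym (negbTE va) !mul0r.
rewrite /pair_coef wi wj eqxx !mul1r /contr mulr_sumr.
by apply: eq_bigr => b _; rewrite mulrA.
Qed.

Lemma contr_free i j v phi w l a : i != j -> (l == i) || (l == j) ->
  contr i j v phi (upd w l a) = contr i j v phi w.
Proof.
move=> ij; rewrite /contr => /orP[/eqP->|/eqP->]; apply: eq_bigr => b _.
  by rewrite upd_upd.
by rewrite -(updC w b a ij) upd_upd.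
Qed.

(** The boundary terms at the slots [i] and [j] that are missing from the smaller
derivation cancel, because the form is itself invariant. *)
Lemma inv_tensor_contr S i j v phi : i \in S -> j \in S -> i != j ->
  inv_tensor S phi -> inv_tensor (S :\ i :\ j) (contr i j v phi).
Proof.
move=> iS jS ij [lie par].
have jSi : j \in S :\ i by rewrite !inE eq_sym ij.
have derD1 c d b w : let u := upd (upd w i b) j (dual B b) in
    der S d c phi u = (b == d)%:R * phi (upd (upd w i c) j (dual B b))
      + (dual B b == d)%:R * phi (upd (upd w i b) j c)
      + \sum_(l in S :\ i :\ j | w l == d) phi (upd (upd (upd w l c) i b)
        j (dual B b)).
  move=> u; rewrite /der 2!big_mkcondr (big_setD1 i iS) (big_setD1 j jSi) /=.
  have ui : u i = b by rewrite /u upd_other // upd_same.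
  have uj : u j = dual B b by rewrite /u upd_same.
  rewrite ui uj addrA; congr (_ + _ + _).
  - by rewrite /u (updC _ _ _ ij) upd_upd (updC _ _ _ ij); case: eqP;
    rewrite ?mul1r ?mul0r.
  - by rewrite /u upd_upd; case: eqP; rewrite ?mul1r ?mul0r.
  apply: eq_bigr => l; rewrite !inE => /and3P[lj li lS].
  by rewrite /u !upd_other // (updC _ _ _ li) -(updC _ _ _ lj).
have derE c d w : der (S :\ i :\ j) d c (contr i j v phi) w =
    \sum_(b | vtx B b == v) sgn B b * der S d c phi (upd (upd w i b) j (dual B b))
    - (vtx B d == v)%:R * sgn B d * phi (upd (upd w i c) j (dual B d))
    - (vtx B (dual B d) == v)%:R * sgn B (dual B d) * phi (upd (upd w i (dual B d))
      j c).
  under [X in _ = X - _ - _]eq_bigr do rewrite derD1 !mulrDr.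
  rewrite !big_split /=.
  have pick (e : L) (F : L -> k) : \sum_(b | vtx B b == v)
    sgn B b * ((b == e)%:R * F b)
     = (vtx B e == v)%:R * sgn B e * F e.
    case: (boolP (vtx B e == v)) => ve; last first.
      rewrite !mul0r big1 // => b vb; case: eqP => [be|];
        last by rewrite mul0r mulr0.
      by rewrite -be vb in ve.
    rewrite (bigD1 e) //= eqxx !mul1r big1 ?addr0 // => b /andP[_ /negbTE->].
    by rewrite mul0r mulr0.
  under [X in _ + X + _ - _ - _]eq_bigr do rewrite (can2_eq (dualK B) (dualK B)).
  rewrite !pick.
  rewrite {1}/der /contr exchange_big /=.
  under [X in _ = _ + _ + X - _ - _]eq_bigr do rewrite mulr_sumr.
  ring.
split=> [a b w vab|a w daa odda].
  rewrite !derE !dualK.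
  under eq_bigr do rewrite lie // mulrCA.
  rewrite -mulr_sumr vab (vtx_dual vab).
  have sab := sgn_dual vab; have sa := sgnK B a; have sb := sgnK B b.
  have e1 : sgn B (dual B b) = sgn B a * sgn B b * sgn B (dual B a).
    by rewrite mulrAC sab mulrAC sb mul1r.
  have e2 : sgn B b = sgn B a * sgn B b * sgn B a by rewrite mulrAC sa mul1r.
  rewrite e1 {2}e2; ring.
rewrite /contr big1 // => b _; rewrite (par a) ?mulr0 //.
have M1 := occ_upd w b a iS; have M2 := occ_upd (upd w i b) (dual B b) a jS.
have ji : j != i by rewrite eq_sym.
rewrite upd_other // in M2.
have M3 : occ S w a = ((w i == a) + ((w j == a) + occ (S :\ i :\ j) w a))%N.
  by rewrite /occ (big_setD1 i iS) (big_setD1 j jSi).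
have M4 : (dual B b == a) = (b == a) by rewrite -{1}daa (can_eq (dualK B)).
rewrite M4 in M2.
have -> : occ S (upd (upd w i b) j (dual B b)) a = (occ (S :\ i :\ j)
  w a + (b == a).*2)%N.
  by rewrite -addnn; lia.
by rewrite oddD odd_double addbF.
Qed.

(* The invariant tensors as a subspace of a finite-dimensional space, so that an
injective endomorphism of it is surjective. *)
Let T := {ffun {ffun I -> L} -> k^o}.

Definition casimirT S (phi : T) : T := [ffun w => casimir S phi w].

Lemma casimirT_linear S : linear (casimirT S).
Proof.
move=> c phi psi; apply/ffunP => w; rewrite !ffunE -casimir_lin.
by apply: eq_casimir => v; rewrite !ffunE.
Qed.

HB.instance Definition _ S := GRing.isLinear.Build k T T _ (casimirT S)
    (casimirT_linear S).

Definition defectT S (phi : T) : {ffun (L * L * {ffun I -> L}) -> k^o} :=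
  [ffun x => (vtx B x.1.1 == vtx B x.1.2)%:R * (der S x.1.2 x.1.1 phi x.2
     - sgn B x.1.1 * sgn B x.1.2 * der S (dual B x.1.1) (dual B x.1.2) phi x.2)].

Lemma derT_lin S a b c (phi psi : T) w :
  der S a b (c *: phi + psi : T) w = c * der S a b phi w + der S a b psi w.
Proof. by rewrite -der_lin; apply: eq_der => v; rewrite !ffunE. Qed.

Lemma defectT_linear S : linear (defectT S).
Proof. by move=> c phi psi; apply/ffunP => w;
  rewrite !ffunE !derT_lin /GRing.scale /=; ring. Qed.

HB.instance Definition _ S := GRing.isLinear.Build k T _ _ (defectT S)
    (defectT_linear S).

Definition oddT S (phi : T) : {ffun (L * {ffun I -> L}) -> k^o} :=
  [ffun x => ((dual B x.1 == x.1) && odd (occ S x.2 x.1))%:R * phi x.2].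

Lemma oddT_linear S : linear (oddT S).
Proof. by move=> c phi psi; apply/ffunP => w; rewrite !ffunE /GRing.scale /=;
  ring. Qed.

HB.instance Definition _ S := GRing.isLinear.Build k T _ _ (oddT S) (oddT_linear S).

Definition inv_tensorT S : {vspace T} := (lker (linfun (defectT S))
    :&: lker (linfun (oddT S)))%VS.

Lemma inv_tensorTP S (phi : T) : reflect (inv_tensor S phi) (phi \in inv_tensorT S).
Proof.
rewrite memv_cap !memv_ker !lfunE /=;
  apply: (iffP andP) => [[/eqP lie /eqP par]|[lie par]].
  split=> [a b w vab|a w daa odda].
    by have /ffunP/(_ (a, b, w)) := lie;
      rewrite !ffunE /= vab eqxx mul1r => /subr0_eq.
  by have /ffunP/(_ (a, w)) := par; rewrite !ffunE /= daa eqxx odda mul1r.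
split; apply/eqP/ffunP => x; rewrite !ffunE.
  by case: eqP => [/lie->|]; rewrite ?subrr ?mulr0 ?mul0r.
by case: eqP => /= [d|]; [case: (boolP (odd _)) => [/(par _ _ d)->|]|];
  rewrite ?mulr0 ?mul0r.
Qed.

(** The first fundamental theorem in inductive form: [contr i j v psi] is
invariant on the remaining slots and [pair_coef i j v] is the form. *)
Theorem inv_tensor_decomposition S phi :
  [pchar k] =i pred0 -> S != set0 -> inv_tensor S phi ->
  exists2 psi, inv_tensor S psi &
    forall w, phi w = \sum_(i in S) \sum_(j in S | j != i)
      \sum_v pair_coef i j v w * contr i j v psi w.
Proof.
move=> char0 S0 inv.
pose phiT : T := [ffun w => phi w].
have invE (f : T) (g : {ffun I -> L} -> k)
  : f =1 g -> inv_tensor S f <-> inv_tensor S g.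
  have h (f1 g1 : {ffun I -> L} -> k)
    : f1 =1 g1 -> inv_tensor S f1 -> inv_tensor S g1.
    move=> e [lie par]; split=> [a b w vab|a w daa odda];
      last by rewrite -e (par a).
    by rewrite -!(eq_der _ _ _ _ e) lie.
  by move=> e; split; apply: h => // x; rewrite e.
have stable : (linfun (casimirT S) @: inv_tensorT S <= inv_tensorT S)%VS.
  apply/subvP => _ /memv_imgP[f fi ->]; rewrite lfunE /=; apply/inv_tensorTP.
  apply/(invE _ (casimir S f)) => [w|]; first by rewrite ffunE.
  by apply: inv_tensor_casimir; apply/inv_tensorTP.
have inj : (inv_tensorT S :&: lker (linfun (casimirT S)) = 0)%VS.
  apply/eqP; rewrite -subv0; apply/subvP => f; rewrite memv_cap memv_ker lfunE /=.
  case/andP => /inv_tensorTP[lie par] /eqP Zf; rewrite memv0; apply/eqP/ffunP => w;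
    rewrite ffunE.
  have Zf0 v : casimir S f v = 0 by move/ffunP/(_ v): Zf; rewrite !ffunE.
  have [e0|] := posnP (energy S w); last exact: (casimir_kernel char0 Zf0).
  (* Energy 0 leaves only orthogonal letters of multiplicity 1, which is odd. *)
  have [i iS] := set0Pn _ S0.
  have mi : (0 < occ S w (w i))%N by rewrite /occ (big_setD1 i iS) /= eqxx.
  have := e0; rewrite /energy => /eqP; rewrite sum_nat_eq0 => /forallP/(_ (w i)).
  rewrite implyTb muln_eq0 => /orP[/eqP m0|]; first by rewrite m0 in mi.
  case: (eqVneq (dual B (w i)) (w i)) => [d|_]; last by rewrite subn0 => /eqP m0;
    rewrite m0 in mi.
  rewrite subn_eq0 => m1; apply: (par (w i)) => //.
  by rewrite (_ : occ S w (w i) = 1%N) //; apply/eqP; rewrite eqn_leq m1.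
have full : (linfun (casimirT S) @: inv_tensorT S)%VS = inv_tensorT S.
  by apply/eqP; rewrite eqEdim stable /= (limg_dim_eq inj) leqnn.
have : phiT \in inv_tensorT S by apply/inv_tensorTP/(invE _ phi) => // w;
  rewrite ffunE.
rewrite -full => /memv_imgP[f fi fE].
exists f; first exact/inv_tensorTP.
move=> w; rewrite -casimir_contr; last exact/inv_tensorTP.
by have /ffunP/(_ w) := fE; rewrite lfunE /= !ffunE.
Qed.

End Words.

(** * The subalgebra generated by a set of functions *)

Section Subalgebra.
Variables (k : fieldType) (X : Type) (S : (X -> k) -> Prop).
Implicit Types F G : X -> k.

Lemma in_subalg_ext F G : F =1 G -> in_subalg S F -> in_subalg S G.
Proof. by move=> FG [m [H [p [SH E]]]]; exists m, H, p; split=> // x;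
  rewrite -FG. Qed.

Lemma in_subalg_const c : in_subalg S (fun=> c).
Proof. by exists 0%N, (fun i : 'I_0 => fun=> c), c%:MP; split=> [[]//|x];
  rewrite mevalC. Qed.

Lemma in_subalg_gen F : S F -> in_subalg S F.
Proof. by move=> SF; exists 1%N, (fun=> F), 'X_ord0; split=> // x;
  rewrite mevalXU. Qed.

(** Two polynomials are combined after renaming their variables apart. *)
Lemma in_subalg_map2 (op : forall n, {mpoly k[n]} -> {mpoly k[n]} -> {mpoly k[n]})
    (o : k -> k -> k) :
  (forall n v (p q : {mpoly k[n]}), (op n p q).@[v] = o p.@[v] q.@[v]) ->
  forall F G, in_subalg S F -> in_subalg S G ->
  in_subalg S (fun x => o (F x) (G x)).
Proof.
move=> opE F G [m [H [p [SH pE]]]] [m' [H' [p' [SH' pE']]]].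
exists (m + m')%N, (fun i => match split i with inl a => H a | inr a => H' a end).
exists (op _ (p \mPo [tuple 'X_(lshift m' i) | i < m])
  (p' \mPo [tuple 'X_(rshift m i) | i < m'])).
split=> [i|x]; first by case: split.
rewrite opE !comp_mpoly_meval pE pE'; congr (o _ _); apply: meval_eq => i.
  by rewrite tnth_mktuple mevalXU (unsplitK (inl i : 'I_m + 'I_m')).
by rewrite tnth_mktuple mevalXU (unsplitK (inr i : 'I_m + 'I_m')).
Qed.

Lemma in_subalgD F G : in_subalg S F -> in_subalg S G -> in_subalg S (fun x =>
    F x + G x).
Proof. by apply: (in_subalg_map2 (op := fun=> +%R)) => n v p q; rewrite mevalD. Qed.

Lemma in_subalgM F G : in_subalg S F -> in_subalg S G -> in_subalg S (fun x =>
    F x * G x).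
Proof. by apply: (in_subalg_map2 (op := fun=> *%R)) => n v p q; rewrite mevalM. Qed.

Lemma in_subalg_sum (J : Type) (r : seq J) (P : pred J) (F : J -> X -> k) :
  (forall j, P j -> in_subalg S (F j)) -> in_subalg S (fun x =>
    \sum_(j <- r | P j) F j x).
Proof.
move=> SF; elim: r => [|j r IH].
  by apply: in_subalg_ext (in_subalg_const 0) => x; rewrite big_nil.
case: (boolP (P j)) => Pj.
  by apply: in_subalg_ext (in_subalgD (SF j Pj) IH) => x; rewrite big_cons Pj.
by apply: in_subalg_ext IH => x; rewrite big_cons (negbTE Pj).
Qed.

Lemma in_subalg_ind (C : (X -> k) -> Prop) :
  (forall F G, F =1 G -> C F -> C G) -> (forall c, C (fun=> c))
    -> (forall F, S F -> C F) ->
  (forall F G, C F -> C G -> C (fun x => F x + G x)) ->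
  (forall F G, C F -> C G -> C (fun x => F x * G x)) ->
  forall F, in_subalg S F -> C F.
Proof.
move=> Cext Cc CS CD CM F [m [H [p [SH pE]]]].
apply: (Cext (fun x => p.@[fun i => H i x])) => [x|]; first by rewrite pE.
elim/mpolyind: p {pE} => [|c mon p _ _ IH].
  by apply: Cext (Cc 0) => x; rewrite meval0.
apply: (Cext (fun x => c * \prod_(i < m) H i x ^+ mon i + p.@[fun i => H i x])).
  by move=> x; rewrite mevalD mevalZ mevalX.
apply: (CD) IH; apply: (CM (fun=> c)) => //.
elim: (index_enum _) => [|i r IH]; first by apply: Cext (Cc 1) => x;
  rewrite big_nil.
apply: (Cext (fun x => H i x ^+ mon i * \prod_(j <- r) H j x ^+ mon j)) => [x|];
  first by rewrite big_cons.
apply: (CM) IH; elim: (mon i) => [|n IHn]; first exact: Cext (Cc 1).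
apply: (Cext (fun x => H i x * H i x ^+ n)) => [x|]; first by rewrite exprS.
by apply: CM => //; apply: CS.
Qed.

End Subalgebra.

(** * Evaluating invariant tensors on bivectors *)

Section Evaluation.
Variables (k : fieldType) (V L I : finType) (B : paired_basis k V L).
Implicit Types (S : {set I}) (w : {ffun I -> L}) (phi : {ffun I -> L} -> k).

(** Contraction of the tensor [phi] with one bivector [p] for each pair of slots
listed in [l]. The word [w] provides the letters of the slots that [l] does not
mention; keeping these slots avoids any renumbering when two slots are removed. *)
Fixpoint ev (l : seq (I * I * (L -> L -> k))) phi w : k :=
  if l is (i, j, p) :: l' then
    \sum_a \sum_b p a b * ev l' phi (upd (upd w i a) j b)
  else phi w.

Definition slots (T : Type) (l : seq (I * I * T)) : seq I :=
  flatten [seq [:: t.1.1; t.1.2] | t <- l].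

Lemma eq_ev l phi psi w : phi =1 psi -> ev l phi w = ev l psi w.
Proof.
move=> e; elim: l w => [|[[i j] p] l IH] w //=.
by apply: eq_bigr => a _; apply: eq_bigr => b _; rewrite IH.
Qed.

Lemma ev_sum l (J : Type) (r : seq J) (P : pred J) (F : J -> {ffun I -> L} -> k) w :
  ev l (fun w => \sum_(j <- r | P j) F j w) w = \sum_(j <- r | P j) ev l (F j) w.
Proof.
elim: l w => [|[[i j] p] l IH] w //=.
rewrite [RHS]exchange_big; apply: eq_bigr => a _; rewrite [RHS]exchange_big;
  apply: eq_bigr => b _.
by rewrite IH mulr_sumr.
Qed.

Lemma ev_free l phi w i a : i \notin slots l -> (forall v b, phi (upd v i b)
    = phi v) ->
  ev l phi (upd w i a) = ev l phi w.
Proof.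
move=> il free; elim: l w il => [|[[c d] p] l IH] w //=.
rewrite !inE !negb_or => /and3P[ic id il].
apply: eq_bigr => b _; apply: eq_bigr => e _; congr (_ * _).
by rewrite (updC _ _ _ ic) (updC _ _ _ id) IH.
Qed.

Lemma ev_coef l (c : {ffun I -> L} -> k) phi w :
  (forall i v a, i \in slots l -> c (upd v i a) = c v) ->
  ev l (fun v => c v * phi v) w = c w * ev l phi w.
Proof.
elim: l w => [|[[i j] p] l IH] w //= free.
rewrite mulr_sumr; apply: eq_bigr => a _; rewrite mulr_sumr; apply: eq_bigr => b _.
rewrite IH => [|i' v a' il]; last by apply: free; rewrite !inE il !orbT.
by rewrite !free ?inE ?eqxx ?orbT // mulrCA.
Qed.

Lemma ev_flip i j p l phi w : i != j ->
  ev ((i, j, p) :: l) phi w = ev ((j, i, fun a b => p b a) :: l) phi w.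
Proof.
move=> ij /=; rewrite exchange_big; apply: eq_bigr => a _; apply: eq_bigr => b _.
by rewrite updC.
Qed.

Lemma ev_swap i j p i' j' q l phi w : uniq [:: i; j; i'; j'] ->
  ev [:: (i, j, p), (i', j', q) & l] phi w = ev [:: (i', j', q), (i, j, p) & l]
    phi w.
Proof.
rewrite /= !inE !negb_or andbT => /and3P[/and3P[ij ii' ij'] /andP[ji' jj'] i'j'].
under eq_bigr do under eq_bigr do rewrite mulr_sumr.
under eq_bigr do under eq_bigr do under eq_bigr do rewrite mulr_sumr.
under [RHS]eq_bigr do under eq_bigr do rewrite mulr_sumr.
under [RHS]eq_bigr do under eq_bigr do under eq_bigr do rewrite mulr_sumr.
under eq_bigr do rewrite exchange_big /=.
rewrite exchange_big /=; apply: eq_bigr => a _.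
under eq_bigr do rewrite exchange_big /=.
rewrite exchange_big /=; apply: eq_bigr => b _.
apply: eq_bigr => c _; apply: eq_bigr => d _.
rewrite mulrCA; congr (_ * (_ * ev _ _ _)).
by rewrite (updC _ _ _ ji') (updC _ _ _ ii') (updC _ _ _ jj') (updC _ _ _ ij').
Qed.

(* Bivectors and evaluations that depend on a parameter in [X]. *)
Variables (X : Type) (C : (X -> L -> L -> k) -> Prop).

Definition inst x (l : seq (I * I * (X -> L -> L -> k))) :=
  [seq (t.1, t.2 x) | t <- l].

Lemma slots_inst x l : slots (inst x l) = slots l.
Proof. by rewrite /slots /inst -map_comp. Qed.

Fixpoint all_in (l : seq (I * I * (X -> L -> L -> k))) : Prop :=
  if l is t :: l' then C t.2 /\ all_in l' else True.

Hypothesis C_flip : forall p, C p -> C (fun x a b => p x b a).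

(** Any slot may be assumed to be the first slot of the first bivector. *)
Lemma ev_extract l i : uniq (slots l) -> i \in slots l -> all_in l ->
  exists j p l', [/\ perm_eq (slots l) [:: i, j & slots l'],
    size l = (size l').+1, C p, all_in l' &
    forall x phi w, ev (inst x l) phi w = ev ((i, j, p x) :: inst x l') phi w].
Proof.
elim: l => [|[[c d] p] l IH] //= /and3P[];
  rewrite inE negb_or => /andP[cd cl] dl ul.
rewrite !inE => /or3P[/eqP->|/eqP->|il] [Cp Cl].
- by exists d, p, l; split=> //; rewrite perm_refl.
- exists c, (fun x a b => p x b a), l; split=> //; last by move=> x phi w;
  exact: ev_flip.
    exact/permEl/(perm_catCA [:: c] [:: d] (slots l)).
  exact: C_flip.
have [j [q [l' [P sz Cq Cl' E]]]] := IH ul il Cl.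
exists j, q, ((c, d, p) :: l'); split=> //=.
- have : perm_eq ([:: c; d] ++ slots l) ([:: c;
  d] ++ [:: i, j & slots l']) by rewrite perm_cat2l.
  move/perm_trans; apply; exact/permEl/(perm_catCA [:: c; d] [:: i; j] (slots l')).
- by rewrite sz.
move=> x phi w.
transitivity (ev [:: (c, d, p x), (i, j, q x) & inst x l'] phi w).
  by apply: eq_bigr => a _; apply: eq_bigr => b _; rewrite E.
rewrite ev_swap //.
have := ul; rewrite (perm_uniq P) /= !inE !negb_or => /and3P[/andP[ij _] _ _].
rewrite !(perm_mem P) !inE !negb_or in cl dl.
case/and3P: cl => ci cj _; case/and3P: dl => di dj _.
by rewrite cd ci cj di dj ij.
Qed.

(** The bivector left by inserting the form in the first slots of [p] and [q]; the
slots that remain are the second ones. *)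
Definition glue (v : V) (p q : L -> L -> k) : L -> L -> k := fun a b =>
  \sum_(c | vtx B c == v) sgn B c * (p c a * q (dual B c) b).

Definition close (v : V) (p : L -> L -> k) : k :=
  \sum_(c | vtx B c == v) sgn B c * p c (dual B c).

Lemma sum_pair (v : V) (F : L -> L -> k) :
  \sum_a \sum_b F a b * ((vtx B a == v)%:R * (b == dual B a)%:R * sgn B a)
  = \sum_(a | vtx B a == v) sgn B a * F a (dual B a).
Proof.
rewrite (bigID (fun a => vtx B a == v)) /= [X in _ + X]big1 ?addr0 =>
  [|a /negbTE->]; last first.
  by rewrite big1 // => b _; rewrite !mul0r mulr0.
apply: eq_bigr => a ->;
  rewrite (bigD1 (dual B a)) //= big1 ?addr0 => [|b /negbTE->].
  by rewrite eqxx !mul1r mulrC.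
by rewrite mulr0 mul0r mulr0.
Qed.

Hypothesis C_glue : forall v p q, C p -> C q -> C (fun x => glue v (p x) (q x)).
Variable Gen : (X -> k) -> Prop.
Hypothesis C_close : forall v p, C p -> in_subalg Gen (fun x => close v (p x)).
Hypothesis char0 : [pchar k] =i pred0.

(** Induction on the number of bivectors: by [inv_tensor_decomposition] it is enough
to treat an inserted form. If its two slots carry the same bivector, a factor
[close] splits off; otherwise two bivectors are replaced by one, their [glue]. *)
Lemma ev_in_subalg l phi w : uniq (slots l) -> all_in l ->
  inv_tensor B [set i in slots l] phi ->
  in_subalg Gen (fun x => ev (inst x l) phi w).
Proof.
have [n] := ubnP (size l); elim: n => // n IH in l phi w *;
  rewrite ltnS => sz ul Cl inv.
have [l0|lN] := eqVneq (size l) 0%N.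
  by rewrite (size0nil l0); exact: (in_subalg_const Gen (phi w)).
have S0 : [set i in slots l] != set0.
  by case: (l) lN => // [[[i j] p] l'] _; apply/set0Pn; exists i; rewrite !inE eqxx.
have [psi ipsi phiE] := inv_tensor_decomposition char0 S0 inv.
apply: (@in_subalg_ext _ _ _ (fun x => \sum_(i in [set i in slots l])
  \sum_(j in [set i in slots l] | j != i) \sum_v
    ev (inst x l) (fun w => pair_coef B i j v w * contr B i j v psi w) w)).
  move=> x; rewrite (eq_ev _ _ phiE) ev_sum; apply: eq_bigr => i _.
  by rewrite ev_sum; apply: eq_bigr => j _; rewrite ev_sum.
apply: in_subalg_sum => i iS; apply: in_subalg_sum => j /andP[jS ji];
  apply: in_subalg_sum => v _.
have ij : i != j by rewrite eq_sym.
have ich := inv_tensor_contr v iS jS ij ipsi.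
set chi := contr B i j v psi in ich *.
have freei u a : chi (upd u i a) = chi u by apply: contr_free; rewrite ?eqxx.
have freej u a : chi (upd u j a) = chi u by apply: contr_free; rewrite ?eqxx ?orbT.
rewrite !inE in iS jS.
have [i0 [p [l1 [P1 sz1 Cp Cl1 E1]]]] := ev_extract ul iS Cl.
have := ul; rewrite (perm_uniq P1) => /= /and3P[];
  rewrite inE negb_or => /andP[ii0 il1] i0l1 ul1.
have inv_rest (r : seq I) : (forall l', (l' \in slots l) && (l' != i) && (l' != j)
  = (l' \in r)) ->
    inv_tensor B [set l' in r] chi.
  move=> rE; rewrite (_ : [set l' in r] = [set l' in slots l] :\ i :\ j) //.
  by apply/setP => l'; rewrite !inE -rE; case: (l' \in slots l); case: (l' == i);
    case: (l' == j).
have coef_free (r : seq I) u i' b : i \notin r -> j \notin r -> i' \in r ->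
    pair_coef B i j v (upd u i' b) = pair_coef B i j v u.
  move=> ir jr i'r; rewrite /pair_coef !upd_other //;
    first by apply: contraNneq jr => ->.
  by apply: contraNneq ir => ->.
(* [i0] is the other slot of the bivector that occupies [i]. *)
have [i0j|i0j] := eqVneq i0 j.
  subst i0.
  apply: (@in_subalg_ext _ _ _ (fun x => close v (p x) * ev (inst x l1) chi w)) =>
    [x|].
    rewrite E1 /= /close -(sum_pair v (p x)) mulr_suml; apply: eq_bigr => a _.
    rewrite mulr_suml; apply: eq_bigr => b _; rewrite -mulrA; congr (_ * _).
    rewrite ev_coef; last first.
      move=> i' u c; rewrite /inst slots_inst => i'l; exact: (coef_free (slots l1)).
    rewrite !ev_free ?slots_inst // /pair_coef upd_same upd_other // upd_same.
    by [].
  apply: in_subalgM; first exact: C_close.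
  apply: IH => //; first by rewrite sz1 in sz.
  apply: inv_rest => l'; rewrite (perm_mem P1) !inE.
  case: (eqVneq l' i) => [->|_] /=; first by rewrite (negbTE il1).
  by case: (eqVneq l' j) => [->|_] /=; rewrite ?(negbTE i0l1) ?andbT.
have jl1 : j \in slots l1.
  by move: jS; rewrite (perm_mem P1) !inE (negbTE ji) eq_sym (negbTE i0j).
have [j0 [q [l2 [P2 sz2 Cq Cl2 E2]]]] := ev_extract ul1 jl1 Cl1.
have := ul1; rewrite (perm_uniq P2) => /= /and3P[];
  rewrite inE negb_or => /andP[jj0 jl2] j0l2 ul2.
have {}il1 : (i != j0) && (i \notin slots l2).
  by move: il1; rewrite (perm_mem P2) !inE !negb_or => /and3P[_ -> ->].
have {}i0l1 : (i0 != j0) && (i0 \notin slots l2).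
  by move: i0l1; rewrite (perm_mem P2) !inE !negb_or => /and3P[_ -> ->].
case/andP: il1 => ij0 il2; case/andP: i0l1 => i0j0 i0l2.
pose pq x := glue v (p x) (q x).
apply: (@in_subalg_ext _ _ _ (fun x => ev (inst x ((i0, j0, pq) :: l2)) chi w)) =>
  [x|].
  rewrite E1 /=.
  under [RHS]eq_bigr do under eq_bigr do rewrite E2 /= mulr_sumr.
  rewrite [RHS]exchange_big; apply: eq_bigr => a0 _ /=.
  under [RHS]eq_bigr do under eq_bigr do rewrite mulr_sumr.
  under [RHS]eq_bigr do rewrite exchange_big /=.
  rewrite [RHS]exchange_big; apply: eq_bigr => b0 _ /=.
  rewrite /pq /glue -[X in X * _](sum_pair v (fun c d =>
    p x c a0 * q x d b0)) mulr_suml.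
  apply: eq_bigr => a _; rewrite mulr_suml; apply: eq_bigr => b _.
  rewrite ev_coef; last first.
    move=> i' u c; rewrite slots_inst => i'l; exact: (coef_free (slots l2)).
  rewrite -!mulrA; congr (_ * (_ * _)).
  have -> : upd (upd (upd (upd w i a) i0 a0) j b)
    j0 b0 = upd (upd (upd (upd w i0 a0) j0 b0) i a) j b.
    rewrite (updC w a a0 ii0) (updC _ b b0 jj0).
    by rewrite (updC _ a b0 ij0).
  rewrite /pair_coef upd_same [upd _ j b i]upd_other // upd_same.
  have freei' u c : ev (inst x l2) chi (upd u i c) = ev (inst x l2) chi u.
    by apply: ev_free; rewrite ?slots_inst.
  have freej' u c : ev (inst x l2) chi (upd u j c) = ev (inst x l2) chi u.
    by apply: ev_free; rewrite ?slots_inst.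
  by rewrite freej' freei'.
apply: IH.
- by rewrite /= -sz2 -ltnS -sz1.
- by rewrite /= inE negb_or i0j0 i0l2 j0l2.
- by split; first exact: C_glue.
apply: inv_rest => l'; rewrite (perm_mem P1) !inE (perm_mem P2) !inE.
case: (eqVneq l' i) => [->|l'i] /=.
  by rewrite (negbTE ii0) (negbTE ij0) (negbTE il2).
case: (eqVneq l' j) => [->|_] /=; last by rewrite !andbT.
by rewrite andbF eq_sym (negbTE i0j) (negbTE jj0) (negbTE jl2).
Qed.
End Evaluation.

(** With the slots of [l] distinct, [ev] is the usual sum over all words. *)
Lemma ev_words (k : fieldType) (L I : finType) (l : seq (I * I * (L -> L -> k)))
    phi (w : {ffun I -> L}) :
  uniq (slots l) -> ev l phi w =
  \sum_(w' : {ffun I -> L} | [forall i, (i \notin slots l) ==> (w' i == w i)])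
     phi w' * \prod_(t <- l) t.2 (w' t.1.1) (w' t.1.2).
Proof.
elim: l w => [|[[i j] p] l IH] w /=.
  move=> _; rewrite (big_pred1 w) => [|w' /=]; first by rewrite big_nil mulr1.
  by apply/forallP/eqP => [e|-> i]; [apply/ffunP => i; apply/eqP/e | rewrite eqxx].
rewrite inE negb_or -andbA => /and4P[ij il jl ul].
rewrite [RHS](partition_big (fun w' : {ffun I -> L} => w' i) predT) //=;
  apply: eq_bigr => a _.
rewrite [RHS](partition_big (fun w' : {ffun I -> L} => w' j) predT) //=;
  apply: eq_bigr => b _.
rewrite IH // mulr_sumr; apply: eq_big => [w'|w' /forallP e].
  apply/forallP/andP => [e|[/andP[/forallP e /eqP wi] /eqP wj] i'].
    have := e i; rewrite il upd_other // upd_same /= => ->.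
    have := e j; rewrite jl upd_same /= => ->; split=> //; rewrite andbT;
      apply/forallP => i'.
    apply/implyP; rewrite !inE !negb_or => /and3P[i'i i'j i'l].
    by have := e i'; rewrite i'l !upd_other.
  apply/implyP => i'l; rewrite !ffunE; case: (eqVneq i' j) => [->|i'j];
    first by rewrite wj.
  case: (eqVneq i' i) => [->|i'i]; first by rewrite wi.
  by have := e i'; rewrite !inE !negb_or i'l i'i i'j.
have := e i; rewrite il upd_other // upd_same /= => /eqP wi.
have := e j; rewrite jl upd_same /= => /eqP wj.
by rewrite big_cons /= wi wj; ring.
Qed.

(** * Polarization of invariant polynomials *)

Section Polarization.
Variables (k : fieldType) (C : finType).
Hypothesis char0 : [pchar k] =i pred0.

Definition tensor_eval d (tau : {ffun 'I_d -> C} -> k) (v : 'I_d -> C -> k) : k :=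
  \sum_u tau u * \prod_r v r (u r).

Definition form_eval d tau (v : C -> k) := @tensor_eval d tau (fun=> v).

Definition symmetric_tensor d (tau : {ffun 'I_d -> C} -> k) :=
  forall (s : 'S_d) (u : {ffun 'I_d -> C}), tau [ffun r => u (s r)] = tau u.

Lemma tensor_eval_perm d tau (s : 'S_d) v :
  tensor_eval tau (fun r => v (s r)) = tensor_eval (fun u => tau [ffun r =>
    u (s r)]) v.
Proof.
rewrite /tensor_eval.
pose h (t : 'S_d) (u : {ffun 'I_d -> C}) := [ffun r => u (t r)].
have hK (t t' : 'S_d) : (forall r, t (t' r) = r) -> cancel (h t) (h t').
  by move=> tK u; apply/ffunP => r; rewrite !ffunE tK.
rewrite (reindex_onto (h s) (h s^-1%g)) /=; last by move=> u _; apply: hK;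
  exact: permK.
rewrite (eq_bigl xpredT) => [|u]; last by apply/eqP/hK; exact: permKV.
apply: eq_bigr => u _; congr (_ * _).
rewrite [RHS](reindex_inj (@perm_inj _ s)); apply: eq_bigr => r _; by rewrite ffunE.
Qed.

Lemma tensor_eval_sym d tau (s : 'S_d) v : symmetric_tensor tau ->
  tensor_eval tau (fun r => v (s r)) = tensor_eval tau v.
Proof. by move=> sym; rewrite tensor_eval_perm; apply: eq_bigr => u _;
  rewrite sym. Qed.

(** Subsets cancel in pairs that differ by [x] only. *)
Lemma alt_sum_supset (T : finType) (x : T) (f : {set T} -> k) :
  (forall S, f (x |: S) = f (S :\ x)) ->
  \sum_(S : {set T}) (-1) ^+ #|S| * f S = 0.
Proof.
move=> fx; rewrite (bigID (fun S : {set T} => x \in S)) /=.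
rewrite (reindex_onto (fun S => x |: S) (fun S => S :\ x)) /=; last by move=> S xS;
  rewrite setD1K.
rewrite (eq_bigl (fun S : {set T} => x \notin S)) => [|S]; last first.
  rewrite setU11 /=; apply/eqP/idP => [<-|xS]; first by rewrite !inE eqxx.
  by rewrite setU1K.
rewrite -big_split big1 //= => S xS.
rewrite cardsU1 xS fx exprS mulN1r (_ : S :\ x = S) ?addNr //;
  first by rewrite mulNr addNr.
by apply/setP => y; rewrite !inE; case: (eqVneq y x) => [->|//];
  rewrite (negbTE xS).
Qed.

(** Expanding the right-hand side gives a sum over maps [h] of ['I_d] to itself, in
which the signs add up to 0 unless [h] is surjective, that is, a permutation. *)
Lemma polarization d tau (v : 'I_d -> C -> k) : symmetric_tensor tau ->
  (d`!)%:R * tensor_eval tau v =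
  \sum_(S : {set 'I_d}) (-1) ^+ (d + #|S|) *
    form_eval tau (fun x => \sum_(i in S) v i x).
Proof.
move=> sym.
have expand (S : {set 'I_d}) : form_eval tau (fun x => \sum_(i in S) v i x) =
    \sum_(h : {ffun 'I_d -> 'I_d})
      (h \in ffun_on (mem S))%:R * tensor_eval tau (fun r => v (h r)).
  rewrite /form_eval /tensor_eval.
  under eq_bigr do rewrite bigA_distr_big mulr_sumr.
  rewrite exchange_big /= big_mkcond; apply: eq_bigr => h _.
  by case: ifP => _; rewrite ?mul1r ?mul0r.
under eq_bigr do rewrite expand mulr_sumr.
rewrite exchange_big /=.
under eq_bigr => h _.
  rewrite (_ : \sum_S _ = (\sum_(S : {set 'I_d}) (-1)
    ^+ #|S| * (h \in ffun_on (mem S))%:R) *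
      ((-1) ^+ d * tensor_eval tau (fun r => v (h r)))); last first.
    by rewrite mulr_suml; apply: eq_bigr => S _; rewrite exprD; ring.
over.
rewrite (bigID (fun h : {ffun 'I_d -> 'I_d} =>
  injectiveb h)) /= [X in _ + X]big1 ?addr0; last first.
  move=> h hN.
  have [x xh] : exists x, x \notin codom h.
    apply/existsP; apply: contraNT hN; rewrite negb_exists => /forallP cov.
    have /image_injP hinj : #|image h 'I_d| == #|'I_d|.
      by apply/eqP/eq_card => y; rewrite !inE; apply: contraNT (cov y).
    by apply/injectiveP => y z; apply: hinj.
  have hx r : h r != x by apply: contraNneq xh => <-; exact: codom_f.
  rewrite (alt_sum_supset (x := x)) ?mul0r // => S; congr (nat_of_bool _)%:R.
  by apply/ffun_onP/ffun_onP => H r; have := H r; rewrite !inE (negbTE (hx r)).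
rewrite (reindex (@pval _)) /=; last first.
  pose in_Sn := insubd (1%g : 'S_d).
  by exists in_Sn => /= f Uf; first apply: val_inj; exact: insubdK.
rewrite (eq_bigl xpredT) => [|s]; last by rewrite (valP s).
rewrite (eq_bigr (fun=> tensor_eval tau v)) => [|s _]; last first.
  (* A permutation takes its values in the full set only. *)
  rewrite (bigD1 setT) //= big1 ?addr0 => [|S ST]; last first.
    case: (boolP (_ \in _)) => [/ffun_onP sS|_]; last by rewrite mulr0.
    by case/eqP: ST; apply/setP => x; have := sS (s^-1%g x);
      rewrite pvalE permKV inE.
  rewrite (_ : _ \in _) ?mulr1; last by apply/ffun_onP => x; rewrite inE.
  rewrite cardsT card_ord mulrA -exprD addnn -signr_odd odd_double mul1r.
  rewrite -(tensor_eval_sym s v sym); apply: eq_bigr => u _; congr (_ * _).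
  by apply: eq_bigr => r _; rewrite pvalE.
by rewrite sumr_const card_Sn mulr_natl.
Qed.

(** A polynomial as a list of coefficients and monomials, a monomial being a list of
coordinates. *)
Definition monomial_sum (l : seq (k * seq C)) (v : C -> k) : k :=
  \sum_(t <- l) t.1 * \prod_(x <- t.2) v x.

Definition coef_tensor (l : seq (k * seq C)) d (u : {ffun 'I_d -> C}) : k :=
  \sum_(t <- l) t.1 * (t.2 == codom u)%:R.

Lemma form_eval_coef l d v :
  form_eval (@coef_tensor l d) v = \sum_(t <- l | size t.2 == d)
    t.1 * \prod_(x <- t.2) v x.
Proof.
rewrite /form_eval /tensor_eval /coef_tensor.
under eq_bigr do rewrite mulr_suml.
rewrite exchange_big [RHS]big_mkcond /=; apply: eq_bigr => -[c s] _ /=.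
case: eqP => [sz|sz]; last first.
  by rewrite big1 // => u _; case: eqP => [sE|]; rewrite ?mulr0 ?mul0r //;
    rewrite sE size_codom card_ord in sz.
have szd : size s == d by apply/eqP.
pose u0 : {ffun 'I_d -> C} := [ffun r => tnth (Tuple szd) r].
have u0E : codom u0 = s.
  by rewrite codomE (eq_map (ffunE _)) (map_tnth_enum (Tuple szd)).
rewrite (bigD1 u0) //= [X in _ + X]big1 ?addr0 => [|u uN].
  rewrite u0E eqxx mulr1; congr (_ * _).
  by rewrite -[in RHS]u0E codomE big_map big_enum.
case: eqP => [sE|]; rewrite ?mulr0 ?mul0r //; case/eqP: uN; apply/ffunP => r.
by have := sE; rewrite -u0E !codomE => /eq_in_map ->; rewrite ?mem_enum.
Qed.

Definition sym_tensor d (tau : {ffun 'I_d -> C} -> k) (u : {ffun 'I_d -> C}) : k :=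
  (d`!)%:R^-1 * \sum_(s : 'S_d) tau [ffun r => u (s r)].

Lemma sym_tensor_sym d (tau : {ffun 'I_d -> C} -> k)
    : symmetric_tensor (sym_tensor tau).
Proof.
move=> s u; congr (_ * _); rewrite [RHS](reindex_inj (mulIg s)) /=;
  apply: eq_bigr => t _.
by congr tau; apply/ffunP => r; rewrite !ffunE permM.
Qed.

Lemma fact_neq0 d : (d`!)%:R != 0 :> k.
Proof. by move/pcharf0P: char0 => ->; rewrite -lt0n fact_gt0. Qed.

Lemma form_eval_sym d (tau : {ffun 'I_d -> C} -> k) v :
  form_eval (sym_tensor tau) v = form_eval tau v.
Proof.
rewrite /form_eval {1}/tensor_eval /sym_tensor.
under eq_bigr do rewrite -mulrA mulr_suml.
rewrite -mulr_sumr exchange_big /=.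
rewrite (eq_bigr (fun=> tensor_eval tau (fun=> v))) => [|s _]; last first.
  by rewrite (tensor_eval_perm _ s (fun=> v)).
by rewrite sumr_const card_Sn -[X in _ * X]mulr_natl mulKf ?fact_neq0.
Qed.

Lemma eq_tensor_eval d (tau : {ffun 'I_d -> C} -> k) v v' :
  (forall r, v r =1 v' r) -> tensor_eval tau v = tensor_eval tau v'.
Proof.
by move=> e; apply: eq_bigr => u _; congr (_ * _); apply: eq_bigr => r _; rewrite e.
Qed.

Definition mxact (A : C -> C -> k) (v : C -> k) x := \sum_y A x y * v y.

Lemma monomial_sum_parts l : exists2 N, forall t,
    t \in l -> (size t.2 < N)%N & forall v,
  monomial_sum l v = \sum_(d < N) form_eval (sym_tensor (@coef_tensor l d)) v.
Proof.
have [N ltN] : exists N, forall t, t \in l -> (size t.2 < N)%N.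
  by exists (\max_(t <- l) size t.2).+1 => t tl;
    rewrite ltnS (leq_bigmax_seq (F := fun t => size t.2)).
exists N => [t /ltN//|v].
under [RHS]eq_bigr do rewrite form_eval_sym form_eval_coef.
rewrite (exchange_big_dep predT) //= /monomial_sum !big_seq;
  apply: eq_bigr => t /ltN lt.
by rewrite (big_pred1 (Ordinal lt)) // => i /=; rewrite eq_sym.
Qed.

Lemma form_eval_scale d (tau : {ffun 'I_d -> C} -> k) v c :
  form_eval tau (fun x => c * v x) = c ^+ d * form_eval tau v.
Proof.
rewrite /form_eval /tensor_eval mulr_sumr; apply: eq_bigr => u _.
by rewrite big_split prodr_const card_ord /= mulrCA.
Qed.

(** Scaling the variable isolates the homogeneous parts of an invariant polynomial;
[polarization] expresses the multilinear form of such a part by its values, so the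
multilinear form is invariant too; its values on basis vectors are the
coefficients. *)
Theorem coef_tensor_invariant l (A : C -> C -> k) :
  (forall v, monomial_sum l (mxact A v) = monomial_sum l v) ->
  forall d u, let tau := sym_tensor (@coef_tensor l d) in
  tau u = \sum_u' tau u' * \prod_r A (u' r) (u r).
Proof.
move=> inv d u tau.
have hom v : form_eval tau (mxact A v) = form_eval tau v.
  have [N NlE NE] := monomial_sum_parts l.
  pose f e w := form_eval (sym_tensor (@coef_tensor l e)) w.
  have [dN|Nd] := ltnP d N; last first.
    by rewrite /tau !form_eval_sym !form_eval_coef [LHS]big_seq_cond
      [RHS]big_seq_cond !big1 // => t /andP[tl /eqP td];
      have := NlE _ tl; rewrite td ltnNge Nd.
  pose p : {poly k} := \poly_(e < N) (f e (mxact A v) - f e v).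
  have p0 : p = 0.
    apply: poly_natroots char0 _ => n; rewrite horner_poly.
    have := inv (fun x => n%:R * v x); rewrite !NE => /eqP;
      rewrite -subr_eq0 -sumrB => /eqP e0; rewrite -[RHS]e0.
    apply: eq_bigr => e _; rewrite form_eval_scale mulrBl -/(f e v)
      [f e v * _]mulrC.
    congr (_ - _); rewrite mulrC -form_eval_scale; apply: eq_tensor_eval => r x.
    by rewrite /mxact mulr_sumr; apply: eq_bigr => y _; rewrite mulrCA.
  have /eqP : p`_d = 0 by rewrite p0 coef0.
  by rewrite coef_poly dN subr_eq0 => /eqP.
have sym : symmetric_tensor tau by exact: sym_tensor_sym.
have polar_inv v : tensor_eval tau (fun r => mxact A (v r)) = tensor_eval tau v.
  apply: (mulfI (fact_neq0 d)); rewrite [LHS]polarization // [RHS]polarization //;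
    apply: eq_bigr => S _; congr (_ * _).
  rewrite -(hom (fun x => \sum_(i in S) v i x)); apply: eq_tensor_eval => r x.
  by rewrite /mxact exchange_big; apply: eq_bigr => y _; rewrite mulr_sumr.
have := polar_inv (fun r y => (y == u r)%:R).
rewrite /tensor_eval [RHS](bigD1 u) //= [X in _ = _ + X]big1 => [|u' u'u];
  last first.
  have [r ru] := ffun_neq u'u.
  by rewrite (bigD1 r) //= (negbTE ru) mul0r mulr0.
rewrite [X in _ * X]big1 => [|r _]; last by rewrite eqxx.
rewrite mulr1 addr0 => <-; apply: eq_bigr => u' _; congr (_ * _);
  apply: eq_bigr => r _.
rewrite /mxact (bigD1 (u r)) //= eqxx mulr1 big1 ?addr0 // => y /negbTE->;
  by rewrite mulr0.
Qed.

End Polarization.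

Lemma in_subalg_monomial (k : fieldType) (X : Type) (S : (X -> k) -> Prop)
    (C : finType)
    (h : (C -> k) -> X) (F : X -> k) :
  (forall G, S G -> exists c x, forall v, G (h v) = c * v x) ->
  in_subalg S F -> exists l, forall v, F (h v) = monomial_sum l v.
Proof.
move=> SC; apply: (@in_subalg_ind _ _ _ (fun F =>
  exists l, forall v, F (h v) = monomial_sum l v)).
- by move=> F1 F2 e [l lE]; exists l => v; rewrite -e lE.
- by move=> c; exists [:: (c, [::])] => v;
  rewrite /monomial_sum big_seq1 big_nil mulr1.
- by move=> G /SC[c [x E]]; exists [:: (c, [:: x])] => v;
  rewrite /monomial_sum !big_seq1 E.
- by move=> F1 F2 [l1 E1] [l2 E2]; exists (l1 ++ l2) => v;
  rewrite /monomial_sum big_cat E1 E2.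
move=> F1 F2 [l1 E1] [l2 E2].
exists [seq (t.1 * u.1, t.2 ++ u.2) | t <- l1, u <- l2] => v.
rewrite E1 E2 /monomial_sum big_allpairs_dep /= mulr_suml; apply: eq_bigr => t _.
rewrite mulr_sumr; apply: eq_bigr => u _; rewrite big_cat /=; ring.
Qed.

(** * From invariance under the group to invariance under its Lie algebra *)

Section Lie.
Variables (k : fieldType) (D : nat) (V I : finType) (B : paired_basis k V 'I_D).
Hypothesis char0 : [pchar k] =i pred0.

Local Notation s := (sgn B).

Definition Phi : 'M[k]_D := \matrix_(x, y) (s x * (y == dual B x)%:R).

Definition preserves_form (G : 'M[k]_D) : Prop :=
  G^T *m Phi *m G = Phi /\ forall x y, vtx B x != vtx B y -> G x y = 0.

Lemma Phi_delta (a b : 'I_D) : Phi *m delta_mx a b = s (dual B a)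
    *: delta_mx (dual B a) b.
Proof.
apply/matrixP => x y; rewrite !mxE (bigD1 a) //= big1 ?addr0 => [|z za]; last first.
  by rewrite !mxE (negbTE za) mulr0.
rewrite !mxE eqxx /= -(can2_eq (dualK B) (dualK B)) eq_sym.
by case: eqP => [->|]; rewrite ?mulr0 ?mul0r ?mulr1 // mulr0.
Qed.

Lemma delta_Phi (a b : 'I_D) : delta_mx a b *m Phi = s b *: delta_mx a (dual B b).
Proof.
apply/matrixP => x y; rewrite !mxE (bigD1 b) //= big1 ?addr0 => [|z zb]; last first.
  by rewrite !mxE (negbTE zb) andbF mul0r.
rewrite !mxE eqxx andbT mulrCA; congr (_ * _).
by case: eqP; case: eqP; rewrite ?mul1r ?mul0r ?mulr0.
Qed.

(** These span the Lie algebra of the group: the elementary matrix minus its adjoint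
for the form [Phi]. *)
Definition skew (a b : 'I_D) : 'M[k]_D := delta_mx a b -
  (s a * s b) *: delta_mx (dual B b) (dual B a).

Lemma skew_tr a b : vtx B a = vtx B b -> (skew a b)^T *m Phi = - (Phi *m skew a b).
Proof.
move=> vab; rewrite /skew linearB linearZ /= !trmx_delta mulmxBl mulmxBr -scalemxAl
  -scalemxAr.
rewrite !Phi_delta !delta_Phi !dualK !scalerA opprB; congr (_ *: _ - _ *: _).
  by rewrite -mulrA sgnK mulr1.
by rewrite -mulrA -(sgn_dual vab) mulrA sgnK mul1r.
Qed.

(** The scalar is a sign or 0 at an orthogonal block; elsewhere it is 1 for a
diagonal element and 0 for the other ones, whose square is 0. Hence the inverse
of [1 - t X] is a polynomial in [X] up to a scalar, and Cayley transforms are given by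
one formula in all cases. *)
Lemma skew_cube a b : vtx B a = vtx B b -> exists lam : k,
  skew a b *m skew a b *m skew a b = lam *: skew a b.
Proof.
move=> vab; have fab := dual_fix vab.
have dinj := inv_inj (dualK B).
have sq : skew a b *m skew a b =
   (a == b)%:R *: (delta_mx a b + delta_mx (dual B b) (dual B a))
   - (s a * s b * (dual B a == a)%:R) *: (delta_mx a (dual B a)
     + delta_mx (dual B b) b).
  rewrite /skew mulmxBl !mulmxBr -!scalemxAl -!scalemxAr !mul_delta_mx_cond.
  rewrite (inj_eq dinj) [b == dual B b]eq_sym -fab [b == a]eq_sym.
  have ss : s a * s b * (s a * s b) = 1 by rewrite mulrACA !sgnK mulr1.
  rewrite scalerA ss scale1r.
  by rewrite -!scaler_nat; apply/matrixP => x y; rewrite !mxE; ring.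
have [aa|aa] := eqVneq (dual B a) a.
  have bb : dual B b = b by apply/eqP; rewrite -fab aa.
  have [ab|ab] := eqVneq a b.
    exists 0; rewrite scale0r (_ : skew a b = 0) ?mul0mx //.
    by rewrite /skew -ab aa sgnK scale1r subrr.
  exists (- (s a * s b));
    rewrite sq aa bb eqxx (negbTE ab) scale0r sub0r mulr1 /skew aa bb.
  rewrite mulNmx -scalemxAl scaleNr; congr (- (_ *: _)).
  rewrite mulmxDl !mulmxBr -!scalemxAr !mul_delta_mx_cond !eqxx [b == a]eq_sym
    (negbTE ab).
  by rewrite !mulr0n !mulr1n scaler0 subr0 sub0r.
have [ab|ab] := eqVneq a b; last by exists 0;
  rewrite sq (negbTE ab) (negbTE aa) mulr0 !scale0r subr0 mul0mx.
exists 1; rewrite sq (negbTE aa)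
  mulr0 ab eqxx !scale0r subr0 !scale1r /skew sgnK scale1r.
rewrite ab in aa; rewrite mulmxDl !mulmxBr !mul_delta_mx_cond !eqxx [b == _]eq_sym
  (negbTE aa).
by rewrite !mulr0n !mulr1n subr0 sub0r.
Qed.

(** [(1 - lam t^2) (1 - t X)^-1 (1 + t X)], when [X^3 = lam X]. *)
Definition cayley_num (lam t : k) (X : 'M[k]_D) : 'M[k]_D :=
  (1 - lam * t ^+ 2)%:M + (2 * t) *: X + (2 * t ^+ 2) *: (X *m X).

Lemma cayley_numE lam t (X : 'M[k]_D) x y : cayley_num lam t X x y =
  (x == y)%:R * (1 - lam * t ^+ 2) + 2 * t * X x y + 2 * t ^+ 2 * (X *m X) x y.
Proof. by rewrite /cayley_num; move: (X *m X) => Y; rewrite !mxE; ring. Qed.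

Lemma cayley_num_gram (X : 'M[k]_D) lam t :
  X^T *m Phi = - (Phi *m X) -> X *m X *m X = lam *: X ->
  (cayley_num lam t X)^T *m Phi *m cayley_num lam t X = (1 - lam * t ^+ 2)
    ^+ 2 *: Phi.
Proof.
move=> XT X3; rewrite /cayley_num;
  have [q qE] : exists q, q = 1 - lam * t ^+ 2 by eexists.
rewrite -qE; set Y := X *m X in X3 *.
have XY : X *m Y = lam *: X by rewrite /Y mulmxA.
have YY : Y *m Y = lam *: Y by rewrite {1}/Y -mulmxA XY -scalemxAr.
have YT : Y^T *m Phi = Phi *m Y.
  by rewrite trmx_mul -mulmxA XT mulmxN mulmxA XT mulNmx opprK mulmxA.
have -> : (q%:M + (2 * t) *: X + (2 * t ^+ 2) *: Y)^T *m Phi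
        = Phi *m (q%:M - (2 * t) *: X + (2 * t ^+ 2) *: Y).
  rewrite !raddfD /= !linearZ /= tr_scalar_mx !mulmxDl mulmxN -!scalemxAl
    -?scalemxAr XT YT.
  by rewrite scalerN mul_scalar_mx mul_mx_scalar.
rewrite -mulmxA -[RHS]mul_mx_scalar; congr (_ *m _).
rewrite !mulmxDl !mulmxDr !mulNmx -!scalemxAl -!scalemxAr X3 YY XY.
rewrite !mul_scalar_mx !mul_mx_scalar.
by apply/matrixP => x y; rewrite !mxE qE; ring.
Qed.

Lemma skew_block a b x y : vtx B a = vtx B b -> vtx B x != vtx B y -> skew a b x y
    = 0.
Proof.
move=> vab xy; rewrite /skew !mxE.
have -> : (x == a) && (y == b) = false.
  by apply: contraNF xy => /andP[/eqP-> /eqP->]; rewrite vab.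
have -> : (x == dual B b) && (y == dual B a) = false.
  by apply: contraNF xy => /andP[/eqP-> /eqP->]; rewrite (vtx_dual vab).
by rewrite mulr0 subr0.
Qed.

Lemma cayley_preserves_form a b lam (t : k) (X := skew a b) : vtx B a = vtx B b ->
  X *m X *m X = lam *: X -> 1 - lam * t ^+ 2 != 0 ->
  preserves_form ((1 - lam * t ^+ 2)^-1 *: cayley_num lam t X).
Proof.
move=> vab X3 q0; have XT : X^T *m Phi = - (Phi *m X) by exact: skew_tr.
split=> [|x y xy].
  rewrite !linearZ /= -!scalemxAl scalerA cayley_num_gram //.
  by rewrite scalerA -expr2 -exprMn mulVf // expr1n scale1r.
have X0 u v : vtx B u != vtx B v -> X u v = 0 by exact: skew_block.
clearbody X; have xNy : (x == y) = false by apply: contraNF xy => /eqP->.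
rewrite /cayley_num !mxE xNy X0 // big1 ?(mulr0, addr0) // => z _.
have [xz|xz] := eqVneq (vtx B x) (vtx B z); last by rewrite X0 // mul0r.
by rewrite (X0 z y) ?mulr0 // -xz.
Qed.

(** The first condition is the coefficient of [t] in the invariance under the Cayley
transform of [t X], multiplied by its denominator so that it becomes an identity
between polynomials in [t]; the second one comes from the reflection that changes
the sign of [a]. *)
Lemma inv_tensor_of_preserves_form (phi : {ffun I -> 'I_D} -> k) :
  (forall G, preserves_form G -> forall w, phi w = \sum_(w' : {ffun I -> 'I_D})
    phi w' * \prod_i G (w' i) (w i)) ->
  inv_tensor B setT phi.
Proof.
move=> inv; split=> [a b w vab|a w daa odda].
  have [lam X3] := skew_cube vab.
  pose q : {poly k} := 1 - lam *: 'X^2.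
  pose h x y : {poly k} := (x == y)%:R *: q + (2 * skew a b x y) *: 'X
     + (2 * (skew a b *m skew a b) x y) *: 'X^2.
  have hE t x y : (h x y).[t] = cayley_num lam t (skew a b) x y.
    by rewrite /h /q cayley_numE !hornerE /=; ring.
  have qE t : q.[t] = 1 - lam * t ^+ 2 by rewrite /q !hornerE.
  pose p : {poly k} := \sum_(w' : {ffun I -> 'I_D}) phi w' *: \prod_i h (w' i) (w i)
    - phi w *: \prod_(i : I) q.
  have p0 : p = 0.
    have q0 : q != 0.
      by apply/eqP => /(congr1 (fun r => r.[0]));
        rewrite qE horner0 expr0n mulr0 subr0 => /eqP; rewrite oner_eq0.
    suff /eqP : p * q = 0 by rewrite mulf_eq0 (negbTE q0) orbF => /eqP.
    (* Multiplying by [q] covers the roots of [q], where the transform is undefined. *)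
    apply: poly_natroots char0 _ => n; rewrite hornerM.
    case: (eqVneq q.[n%:R] 0) => [->|qn]; first by rewrite mulr0.
    rewrite qE in qn; have iso := cayley_preserves_form vab X3 qn.
    rewrite [X in X * _](_ : _ = 0)
      ?mul0r // /p hornerD hornerN hornerZ horner_sum horner_prod.
    rewrite {1}(inv _ iso w) mulr_suml -sumrB big1 // => w' _.
    rewrite hornerZ horner_prod -mulrA -mulrBr.
    rewrite -[X in _ - X]big_split /= [X in _ - X](eq_bigr (fun i =>
      (h (w' i) (w i)).[n%:R])); last first.
      by move=> i _; rewrite qE hE mxE mulrAC mulVf // mul1r.
    by rewrite subrr mulr0.
  have := congr1 (fun r : {poly k} => r`_1) p0.
  rewrite /p coefB coef0 coefZ coef1_prod [X in _ * X]big1 ?mulr0 ?subr0;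
    last first.
    by move=> i _; rewrite /q !coefE mulr0 subr0 mul0r.
  have h0 x y : (h x y)`_0 = (x == y)%:R by rewrite /h /q !coefE /=; ring.
  have h1 x y : (h x y)`_1 = 2 * skew a b x y by rewrite /h /q !coefE /=; ring.
  rewrite coef_sum (_ : \sum_w' _ = 2 * \sum_i \sum_x skew a b x (w i)
    * phi (upd w i x)); last first.
    under eq_bigr do rewrite coefZ coef1_prod mulr_sumr.
    rewrite exchange_big mulr_sumr /=; apply: eq_bigr => i _; rewrite mulr_sumr.
    rewrite (partition_big (fun w' : {ffun I -> 'I_D} => w' i) predT) //=;
      apply: eq_bigr => x _.
    rewrite (bigD1 (upd w i x)) /= ?upd_same //= [X in _ + X]big1 ?addr0 =>
      [|w' /andP[/eqP w'i w'N]].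
      rewrite h1 ?upd_same big1 ?mulr1; last by move=> j ji;
        rewrite h0 upd_other // eqxx.
      by ring.
    have [j /andP[ji w'j]] : exists j, (j != i) && (w' j != w j).
      apply/existsP; apply: contraNT w'N; rewrite negb_exists => /forallP e.
      apply/eqP/ffunP => j; rewrite ffunE; case: (eqVneq j i) => [->//|ji].
      by apply/eqP; have := e j; rewrite ji negbK.
    by rewrite (bigD1 j) //= h0 (negbTE w'j) mul0r !mulr0.
  move/eqP; rewrite mulf_eq0 => /orP[|/eqP e]; first by move/pcharf0P: char0 => ->.
  apply/eqP; rewrite -subr_eq0; apply/eqP; rewrite -[RHS]e /der mulr_sumr.
  rewrite !(big_mkcond (fun i => (i \in setT) && _)) -sumrB; apply: eq_bigr => i _.
  rewrite !inE /skew; under [RHS]eq_bigr do rewrite !mxE mulrBl.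
  rewrite sumrB; congr (_ - _).
    rewrite (bigD1 a) //= big1 ?addr0 => [|x /negbTE ->]; last by rewrite mul0r.
    by rewrite eqxx; case: eqP; rewrite ?mul1r ?mul0r.
  rewrite (bigD1 (dual B b)) //= big1 ?addr0 => [|x /negbTE ->];
    last by rewrite mulr0 mul0r.
  by rewrite eqxx; case: eqP; rewrite ?mulr1 // mulr0 mul0r.
have iso : preserves_form (1%:M - 2 *: delta_mx a a).
  split=> [|x y xy].
    have -> : (1%:M - 2 *: delta_mx a a)^T = 1%:M - 2 *: delta_mx a a :> 'M[k]_D.
      by apply/matrixP => x y; rewrite !mxE eq_sym andbC.
    rewrite mulmxBl mul1mx mulmxBr mulmx1.
    rewrite -scalemxAl -!scalemxAr mulmxBl -!scalemxAl delta_Phi daa Phi_delta daa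
      -!scalemxAl mul_delta_mx.
    by apply/matrixP => x y; rewrite !mxE; ring.
  have xNy : (x == y) = false by apply: contraNF xy => /eqP->.
  have xyNa : (x == a) && (y == a) = false by apply: contraNF xy =>
    /andP[/eqP-> /eqP->].
  by rewrite !mxE xNy xyNa mulr0 subr0.
have := inv _ iso w; rewrite (bigD1 w) //= [X in _ + X]big1 ?addr0 => [|w' w'w];
  last first.
  have [j w'j] := ffun_neq w'w.
  have jNa : (w' j == a) && (w j == a) = false by apply: contraNF w'j =>
    /andP[/eqP-> /eqP->].
  by rewrite (bigD1 j) //= !mxE (negbTE w'j) jNa mulr0 subr0 mul0r mulr0.
rewrite (_ : \prod_i _ = (-1) ^+ occ setT w a); last first.
  rewrite /occ expr_sum; apply: eq_big => [i|i _]; rewrite ?inE // !mxE eqxx andbb.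
  by case: (w i == a); rewrite ?mulr1 ?mulr0 ?subr0 //= expr1; ring.
rewrite -signr_odd odda expr1 mulrN1 => /eqP;
  rewrite -subr_eq0 opprK -mulr2n -mulr_natl mulf_eq0.
by move/pcharf0P: char0 => -> /= /eqP.
Qed.

End Lie.

(** * The letters of a dimension vector *)

Section VertexFinite.
Variables n1 n2 n3 : nat.
Definition vertex_code (v : vertex n1 n2 n3) : 'I_n1 + 'I_n2 + ('I_n3 + 'I_n3) :=
  match v with
  | vs i => inl (inl i)
  | vt j => inl (inr j)
  | vu l => inr (inl l)
  | vustar l => inr (inr l)
  end.
Definition vertex_decode (c : 'I_n1 + 'I_n2 + ('I_n3 + 'I_n3)) : vertex n1 n2 n3 :=
  match c with
  | inl (inl i) => vs i
  | inl (inr j) => vt j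
  | inr (inl l) => vu l
  | inr (inr l) => vustar l
  end.
Lemma vertex_codeK : cancel vertex_code vertex_decode. Proof. by case. Qed.
HB.instance Definition _ := Finite.copy (vertex n1 n2 n3) (can_type vertex_codeK).
End VertexFinite.

Lemma sigmaK n1 n2 n3 : involutive (@sigma n1 n2 n3). Proof. by case. Qed.

Section StandardJ.
Variables (k : fieldType) (m : nat).

Lemma Jdual_subproof (i : 'I_m) : ((if i < m./2 then i + m./2 else i - m./2) < m)%N.
Proof. by have := ltn_ord i; case: ifP; lia. Qed.

(** The symplectic form pairs the basis vectors [i] and [i + m./2], with sign 1 if the
smaller index comes first. *)
Definition Jdual (i : 'I_m) : 'I_m := Ordinal (Jdual_subproof i).
Definition Jsgn (i : 'I_m) : k := if (i < m./2)%N then 1 else -1.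

Hypothesis m_even : ~~ odd m.

Lemma JdualK : involutive Jdual.
Proof.
move=> i; apply: val_inj => /=; have := ltn_ord i; have := odd_double_half m.
rewrite (negbTE m_even) add0n -addnn; case: ifP; case: ifP; lia.
Qed.

Lemma Jdual_neq i : Jdual i != i.
Proof.
apply/eqP => /(congr1 val) /=; have := ltn_ord i; have := odd_double_half m.
rewrite (negbTE m_even) add0n -addnn; case: ifP; lia.
Qed.

Lemma Jsgn_dual i : Jsgn i * Jsgn (Jdual i) = -1.
Proof.
rewrite /Jsgn /=; have := ltn_ord i; have := odd_double_half m.
rewrite (negbTE m_even) add0n -addnn; case: ifP; case: ifP;
  rewrite ?mul1r ?mulr1 //; lia.
Qed.

Lemma Jmx_dual i j : Jmx k m i j = Jsgn i * (j == Jdual i)%:R.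
Proof.
rewrite mxE /Jsgn -val_eqE /=; have := ltn_ord i; have := ltn_ord j;
  have := odd_double_half m.
rewrite (negbTE m_even) add0n -addnn => mE jm im.
case: ltnP => hi.
  have -> : (i == j + m./2 :> nat)%N = false by apply/eqP; lia.
  by rewrite subr0 mul1r.
have -> : (j == i + m./2 :> nat)%N = false by apply/eqP; lia.
rewrite sub0r mulN1r (_ : (i == j + m./2 :> nat)%N = (j == i - m./2 :> nat)%N) //.
by apply/eqP/eqP; lia.
Qed.

End StandardJ.

Section Letters.
Variables (k : fieldType) (n1 n2 n3 : nat) (alpha : vertex n1 n2 n3 -> nat).
Hypothesis Halpha : admissible alpha.
Local Notation vertex := (vertex n1 n2 n3).

Definition letter := {v : vertex & 'I_(alpha v)}.
Local Notation D := #|{: letter}|.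

(** Letters are numbered so that bivectors and elements of the group are square
matrices. *)
Definition letter_idx (v : vertex) (i : 'I_(alpha v)) : 'I_D :=
  enum_rank (Tagged (fun v => 'I_(alpha v)) i).

Definition dual_ord (v : vertex) : 'I_(alpha v) -> 'I_(alpha v) :=
  match v with vt j => @Jdual _ | _ => id end.
Definition sgn_ord (v : vertex) : 'I_(alpha v) -> k :=
  match v with vt j => @Jsgn k _ | _ => fun=> 1 end.

Definition letter_tag (x : 'I_D) : vertex := tag (enum_val x).
Definition letter_dual (x : 'I_D) : 'I_D :=
  letter_idx (cast_ord (admissible_sigma Halpha (tag (enum_val x)))
    (dual_ord (tagged (enum_val x)))).
Definition letter_sgn (x : 'I_D) : k := sgn_ord (tagged (enum_val x)).

Lemma letterP x : exists v (i : 'I_(alpha v)), x = letter_idx i.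
Proof.
exists (tag (enum_val x)), (tagged (enum_val x)).
by rewrite /letter_idx; case: (enum_val x) (enum_valK x) => v i /= <-.
Qed.

Lemma letter_tag_idx v (i : 'I_(alpha v)) : letter_tag (letter_idx i) = v.
Proof. by rewrite /letter_tag /letter_idx enum_rankK. Qed.

Lemma letter_sgn_idx v (i : 'I_(alpha v)) : letter_sgn (letter_idx i) = sgn_ord i.
Proof. by rewrite /letter_sgn /letter_idx enum_rankK. Qed.

Lemma letter_dual_idx v (i : 'I_(alpha v)) :
  letter_dual (letter_idx i) = letter_idx (cast_ord (admissible_sigma Halpha v)
    (dual_ord i)).
Proof. by rewrite /letter_dual {2 3}/letter_idx enum_rankK. Qed.

Lemma letter_idx_inj v : injective (@letter_idx v).
Proof. by move=> i j /enum_rank_inj /eqP;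
  rewrite -tag_eqE /tag_eq /= eqxx tagged_asE => /eqP. Qed.

(** The sign of the symmetry of the form at [v]. *)
Definition vsign (v : vertex) : k := match v with vt _ => -1 | _ => 1 end.

Lemma letter_sgn_dual x : letter_sgn x * letter_sgn (letter_dual x)
    = vsign (letter_tag x).
Proof.
have [v [i ->]] := letterP x;
  rewrite letter_dual_idx !letter_sgn_idx letter_tag_idx.
case: v i => j i /=; rewrite ?mulr1 //.
by rewrite cast_ord_id Jsgn_dual // (proj1 Halpha).
Qed.

Lemma letter_sgnK x : letter_sgn x * letter_sgn x = 1.
Proof.
have [v [i ->]] := letterP x; rewrite letter_sgn_idx.
by case: v i => j i /=; rewrite ?mulr1 // /Jsgn; case: ifP;
  rewrite ?mulr1 // mulrNN mulr1.
Qed.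

Lemma letter_dualK : involutive letter_dual.
Proof.
move=> x; have [v [i ->]] := letterP x; rewrite !letter_dual_idx.
case: v i => j i /=; rewrite ?cast_ord_id ?(JdualK (proj1 Halpha j)) //.
  by congr letter_idx; apply: val_inj.
by congr letter_idx; apply: val_inj.
Qed.

Lemma letter_tag_dual x : letter_tag (letter_dual x) = sigma (letter_tag x).
Proof. by have [v [i ->]] := letterP x;
  rewrite letter_dual_idx !letter_tag_idx. Qed.

Definition is_orth (v : vertex) := if v is vs _ then true else false.

Lemma letter_dual_fix x : (letter_dual x == x) = is_orth (letter_tag x).
Proof.
have [v [i ->]] := letterP x; rewrite letter_tag_idx; case: v i => j i /=.
- by rewrite letter_dual_idx /= cast_ord_id eqxx.
- by rewrite letter_dual_idx /= cast_ord_id (inj_eq (@letter_idx_inj _))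
  (negbTE (Jdual_neq (proj1 Halpha j) i)).
- by apply/eqP => /(congr1 letter_tag); rewrite letter_tag_dual letter_tag_idx.
- by apply/eqP => /(congr1 letter_tag); rewrite letter_tag_dual letter_tag_idx.
Qed.

Lemma letter_vtx_dual a b : letter_tag a = letter_tag b -> letter_tag (letter_dual
    a) = letter_tag (letter_dual b).
Proof. by rewrite !letter_tag_dual => ->. Qed.
Lemma letter_sgn_dual_tag a b : letter_tag a = letter_tag b -> letter_sgn a *
    letter_sgn (letter_dual a) = letter_sgn b * letter_sgn (letter_dual b).
Proof. by rewrite !letter_sgn_dual => ->. Qed.
Lemma letter_dual_fix_tag a b : letter_tag a = letter_tag b -> (letter_dual a == a)
    = (letter_dual b == b).
Proof. by rewrite !letter_dual_fix => ->. Qed.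
Lemma letter_dual_skew a : letter_tag (letter_dual a)
    = letter_tag a -> letter_dual a != a -> letter_sgn a * letter_sgn (letter_dual
    a) = -1.
Proof. by rewrite letter_sgn_dual letter_tag_dual letter_dual_fix;
  case: (letter_tag a). Qed.

Definition letter_basis : paired_basis k vertex 'I_D :=
  @PairedBasis k _ _ letter_tag letter_dual letter_sgn letter_dualK letter_sgnK
    letter_vtx_dual letter_sgn_dual_tag letter_dual_fix_tag letter_dual_skew.

Local Notation B := letter_basis.
Local Notation Phi := (Phi B).

Lemma PhiT_Phi : Phi^T *m Phi = 1%:M.
Proof.
apply/matrixP => x y; rewrite !mxE (bigD1 (letter_dual x)) //= big1 ?addr0 =>
  [|z zx].
  rewrite !mxE /= letter_dualK eqxx mulr1 mulrA letter_sgnK mul1r;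
    by rewrite eq_sym.
by rewrite !mxE /= -(can2_eq letter_dualK letter_dualK) eq_sym (negbTE zx)
  mulr0 mul0r.
Qed.

Lemma mul_PhiT (M : 'M[k]_D) x y : (M *m Phi^T)
    x y = letter_sgn y * M x (letter_dual y).
Proof.
rewrite mxE (bigD1 (letter_dual y)) //= big1 ?addr0 => [|z zy];
  first by rewrite !mxE eqxx mulr1 mulrC.
by rewrite !mxE /= (negbTE zy) !mulr0.
Qed.

(** The inclusion of the space at [v] in the total space, and the one of the space
at [sigma v], whose source is identified with k^(alpha v). *)
Definition incl (v : vertex) : 'M[k]_(D, alpha v) :=
  \matrix_(x, i) (x == letter_idx i)%:R.
Definition dual_incl (v : vertex) : 'M[k]_(D, alpha v) :=
  castmx (erefl, esym (admissible_sigma Halpha v)) (incl (sigma v)).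

Lemma dual_inclE v x i : dual_incl v x i = (x == letter_idx (cast_ord
    (admissible_sigma Halpha v) i))%:R.
Proof. by rewrite castmxE mxE cast_ord_id;
  congr (nat_of_bool (_ == letter_idx _))%:R; apply: val_inj. Qed.

Lemma inclT_mul v m (M : 'M[k]_(D, m)) i j : ((incl v)^T *m M)
    i j = M (letter_idx i) j.
Proof.
rewrite mxE (bigD1 (letter_idx i)) //= big1 ?addr0 => [|z zi];
  first by rewrite !mxE eqxx mul1r.
by rewrite !mxE (negbTE zi) mul0r.
Qed.

Lemma mul_incl v m (M : 'M[k]_(m, D)) i j : (M *m incl v) i j = M i (letter_idx j).
Proof.
rewrite mxE (bigD1 (letter_idx j)) //= big1 ?addr0 => [|z zi];
  first by rewrite !mxE eqxx mulr1.
by rewrite !mxE (negbTE zi) mulr0.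
Qed.

Lemma inclT_incl v : (incl v)^T *m incl v = 1%:M.
Proof. by apply/matrixP => i j;
  rewrite inclT_mul !mxE (inj_eq (@letter_idx_inj _)). Qed.

Lemma inclT_incl0 v w : v != w -> (incl v)^T *m incl w = 0.
Proof.
move=> vw; apply/matrixP => i j; rewrite inclT_mul !mxE;
  case: eqP => // /(congr1 letter_tag).
by rewrite !letter_tag_idx => e; rewrite e eqxx in vw.
Qed.

Lemma form_mxE v i j : form_mx k alpha v i j = sgn_ord i * (j == dual_ord i)%:R.
Proof.
case: v i j => l i j /=; [|exact: (Jmx_dual _ (proj1 Halpha l))| |];
  by rewrite mxE mul1r eq_sym.
Qed.

Lemma dual_ordK v : involutive (@dual_ord v).
Proof. by case: v => // j; exact: (JdualK (proj1 Halpha j)). Qed.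

Lemma form_mx_orth v : (form_mx k alpha v)^T *m form_mx k alpha v = 1%:M.
Proof.
apply/matrixP => i j; rewrite !mxE (bigD1 (dual_ord i)) //= big1 ?addr0 => [|z zx].
  rewrite mxE !form_mxE dual_ordK eqxx mulr1 mulrA -letter_sgn_idx letter_sgnK
    mul1r; by rewrite eq_sym.
by rewrite !mxE !form_mxE -(can2_eq (@dual_ordK v) (@dual_ordK v))
  eq_sym (negbTE zx) mulr0 mul0r.
Qed.

Lemma form_mx_unit v : form_mx k alpha v \in unitmx.
Proof. by case/mulmx1_unit: (form_mx_orth v). Qed.

Lemma invmx_form v : invmx (form_mx k alpha v) = (form_mx k alpha v)^T.
Proof. by rewrite -[RHS](mulmxK (form_mx_unit v)) form_mx_orth mul1mx. Qed.

Lemma inclT_Phi v : (incl v)^T *m Phi = form_mx k alpha v *m (dual_incl v)^T.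
Proof.
apply/matrixP => i y; rewrite inclT_mul mxE /= letter_sgn_idx letter_dual_idx.
rewrite mxE (bigD1 (dual_ord i)) //= big1 ?addr0 => [|z zi].
  by rewrite form_mxE eqxx mulr1 mxE dual_inclE.
by rewrite form_mxE (negbTE zi) mulr0 mul0r.
Qed.

(** The extension of a map by 0 to the total space. *)
Definition tot v w (P : 'M[k]_(alpha w, alpha v))
    : 'M[k]_D := incl w *m P *m (incl v)^T.

Lemma mulmx_cast m m' n n' p q (e1 : m = m') (e2 : n = n') (M1 : 'M[k]_(p, m'))
    (M : 'M[k]_(m, n)) (M2 : 'M[k]_(n', q)) :
  M1 *m castmx (e1, e2) M *m M2 = castmx (erefl, esym e1)
    M1 *m M *m castmx (esym e2, erefl) M2.
Proof. by case: m' / e1 M1; case: n' / e2 M2 => M1 M2; rewrite !castmx_id. Qed.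

(** On the total space, taking adjoints is transposition followed by conjugation by
the single form [Phi], whose inverse is [Phi^T]; all casts disappear here. *)
Lemma tot_adjoint v w (P : 'M[k]_(alpha w, alpha v)) :
  tot (adjoint Halpha P) = Phi^T *m (tot P)^T *m Phi.
Proof.
rewrite /tot /adjoint mulmx_cast -/(dual_incl v) invmx_form.
have -> : castmx (esym (admissible_sigma Halpha w), erefl)
  (incl (sigma w))^T = (dual_incl w)^T.
  by rewrite trmx_cast.
have PhiT_incl : Phi^T *m incl v = dual_incl v *m (form_mx k alpha v)^T.
  by rewrite -[incl v]trmxK -trmx_mul inclT_Phi trmx_mul trmxK.
by rewrite !trmx_mul trmxK !mulmxA PhiT_incl -[RHS]mulmxA inclT_Phi !mulmxA.
Qed.

End Letters.

(** * Paths of the associated quiver as bivectors *)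

Fixpoint path_cat (V : Type) (Q : quiver V) (u v w : V) (c : qpath Q u v)
    (d : qpath Q v w) {struct d} :
    qpath Q u w :=
  match d in qpath _ v0 w0 return qpath Q u v0 -> qpath Q u w0 with
  | path_arrow a => fun c => path_rcons c
  | path_rcons _ a d' => fun c => path_rcons (path_cat c d')
  end c.

Lemma path_mx_cat (k : fieldType) (V : Type) (Q : quiver V) (alpha : V -> nat)
    (f : qrep k Q alpha)
    u v w (c : qpath Q u v) (d : qpath Q v w) :
  path_mx f (path_cat c d) = path_mx f d *m path_mx f c.
Proof. by elim: d c => [a c|v' a d IH c] //=; rewrite IH mulmxA. Qed.

Section Paths.
Variables (k : fieldType) (n1 n2 n3 : nat) (Q : quiver (vertex n1 n2 n3))
    (alpha : vertex n1 n2 n3 -> nat).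
Hypothesis Halpha : admissible alpha.
Local Notation vertex := (vertex n1 n2 n3).
Local Notation B := (letter_basis k Halpha).
Local Notation Phi := (Phi B).
Local Notation Qt := (assoc_quiver Q).
Local Notation rep := (qrep k Q alpha).

Lemma Phi_PhiT : Phi *m Phi^T = 1%:M.
Proof. by apply: mulmx1C; exact: PhiT_Phi. Qed.

Lemma mul_Phi (M : 'M[k]_ #|{: letter alpha}|) x y : (M *m Phi)
    x (letter_dual Halpha y) = M x y * letter_sgn k y.
Proof.
rewrite mxE (bigD1 y) //= big1 ?addr0 => [|z zy]; first by rewrite !mxE eqxx mulr1.
by rewrite !mxE /= (can_eq (letter_dualK Halpha)) eq_sym (negbTE zy) !mulr0.
Qed.

Lemma tot_mul u v w (P : 'M[k]_(alpha w, alpha v)) (P' : 'M_(alpha v, alpha u)) :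
  tot P *m tot P' = tot (P *m P').
Proof. by rewrite /tot !mulmxA -(mulmxA _ _ (incl k alpha v))
  inclT_incl mulmx1. Qed.

Lemma tot_tag v w (P : 'M[k]_(alpha w, alpha v)) x y :
  tot P x y != 0 -> letter_tag x = w /\ letter_tag y = v.
Proof.
have [w' [i ->]] := letterP x; have [v' [j ->]] := letterP y.
rewrite -mul_incl -inclT_mul /tot !mulmxA => H; rewrite !letter_tag_idx; split;
  apply/eqP; apply: contraNT H => e.
  by rewrite inclT_incl0 // !mul0mx mxE.
by rewrite -!mulmxA inclT_incl0 1?eq_sym // !mulmx0 mxE.
Qed.

Lemma tot_tr v (P : 'M[k]_(alpha v)) : \tr (tot P) = \tr P.
Proof. by rewrite /tot mxtrace_mulC mulmxA inclT_incl mul1mx. Qed.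

Lemma Phi_sqE x y : (Phi *m Phi) x y = vsign k (letter_tag x) * (x == y)%:R.
Proof.
rewrite mxE (bigD1 (letter_dual Halpha x)) //= big1 ?addr0 => [|z zx]; last first.
  by rewrite !mxE /= (negbTE zx) mulr0 mul0r.
by rewrite !mxE /= eqxx mulr1 letter_dualK mulrA letter_sgn_dual eq_sym.
Qed.

Lemma Phi_sq_tr : Phi^T *m Phi^T = Phi *m Phi.
Proof.
rewrite -trmx_mul; apply/matrixP => x y; rewrite mxE !Phi_sqE eq_sym.
by case: eqP => [->|]; rewrite ?mulr0.
Qed.

Lemma Phi_sq_incl v : Phi *m Phi *m incl k alpha v = vsign k v *: incl k alpha v.
Proof.
apply/matrixP => x j; rewrite mul_incl Phi_sqE !mxE.
by case: eqP => [->|_]; rewrite ?letter_tag_idx ?mulr0.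
Qed.

Lemma inclT_Phi_sq v : (incl k alpha v)^T *m (Phi *m Phi)
    = vsign k v *: (incl k alpha v)^T.
Proof.
apply/matrixP => i y; rewrite inclT_mul Phi_sqE !mxE letter_tag_idx eq_sym;
  congr (_ * _).
Qed.

Lemma tot_Phi_sq v w (P : 'M[k]_(alpha w, alpha v)) :
  Phi *m Phi *m tot P *m (Phi *m Phi) = (vsign k v * vsign k w) *: tot P.
Proof.
transitivity (Phi *m Phi *m incl k alpha w *m P *m ((incl k alpha v)^T *m (Phi *m
  Phi))).
  by rewrite /tot !mulmxA.
by rewrite Phi_sq_incl inclT_Phi_sq -!scalemxAl -scalemxAr scalerA mulrC.
Qed.

Lemma tot_mul_Phi_sq v w (P : 'M[k]_(alpha w, alpha v)) :
  tot P *m (Phi *m Phi) = vsign k v *: tot P.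
Proof. by rewrite /tot -mulmxA inclT_Phi_sq -scalemxAr. Qed.

(** Stated with a scalar so that reversal, which may introduce a sign, and the zero
function are covered, and existentially so that vertices can be rewritten along
[sigmaK]. *)
Definition path_fun v w (M : rep -> 'M[k]_ #|{: letter alpha}|) : Prop :=
  exists (c : qpath Qt v w)
    (z : k), forall f, M f = z *: tot (path_mx (assoc_rep Halpha f) c).

Lemma path_fun_mul u v w M N : path_fun v w M -> path_fun u v N -> path_fun u w
    (fun f => M f *m N f).
Proof.
move=> [c [z cE]] [d [y dE]]; exists (path_cat d c), (z * y) => f.
by rewrite cE dE path_mx_cat -tot_mul -scalemxAl -scalemxAr scalerA.
Qed.

Lemma path_fun_scale v w M x : path_fun v w M -> path_fun v w (fun f => x *: M f).
Proof. by move=> [c [z cE]]; exists c, (x * z) => f; rewrite cE scalerA. Qed.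

Lemma path_fun_ext v w M N : M =1 N -> path_fun v w M -> path_fun v w N.
Proof. by move=> e [c [z cE]]; exists c, z => f; rewrite -e. Qed.

(** The adjoint of [f a] is the arrow [inr a]; the adjoint of that one is [f a] again,
up to the signs of the two forms. *)
Lemma path_fun_adjoint_arrow (a : arrow Qt) :
  path_fun (sigma (tgt a)) (sigma (src a)) (fun f =>
    Phi^T *m (tot (assoc_rep Halpha f a))^T *m Phi).
Proof.
case: a => a /=.
  exists (path_arrow (Q := Qt) (inr a)), 1 => f /=.
  by rewrite scale1r tot_adjoint.
rewrite !sigmaK.
exists (path_arrow (Q := Qt) (inl a)), (vsign k (src a) * vsign k (tgt a)) => f /=.
by rewrite tot_adjoint !trmx_mul !trmxK -tot_Phi_sq !mulmxA Phi_sq_tr.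
Qed.

Lemma path_fun_adjoint v w (c : qpath Qt v w) :
  path_fun (sigma w) (sigma v) (fun f =>
    Phi^T *m (tot (path_mx (assoc_rep Halpha f) c))^T *m Phi).
Proof.
elim: c => [a|{}v a c IH] /=; first exact: path_fun_adjoint_arrow.
apply: path_fun_ext (path_fun_mul IH (path_fun_adjoint_arrow a)) => f.
rewrite -tot_mul; move: (tot (path_mx _ _)) (tot (assoc_rep _ _ _)) => P A.
by rewrite trmx_mul !mulmxA -(mulmxA _ Phi Phi^T) Phi_PhiT mulmx1.
Qed.

(** Multiplication by [Phi^T] identifies endomorphisms with bivectors. *)
Definition bivector_family (p : rep -> 'I_#|{: letter alpha}| -> 'I_#|{: letter
    alpha}| -> k) : Prop :=
  exists v w, exists2 M, path_fun v w M & forall f x y, p f x y = (M f *m Phi^T)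
    x y.

Lemma path_fun_tag v w M f x y : path_fun v w M -> M f x y != 0 -> letter_tag x = w
    /\ letter_tag y = v.
Proof.
by move=> [c [z E]]; rewrite E mxE mulf_eq0 negb_or => /andP[_ /tot_tag].
Qed.

(** Exchanging the slots of a bivector reverses its path. *)
Lemma bivector_flip p : bivector_family p -> bivector_family (fun f x y => p f y x).
Proof.
move=> [v [w [M [c [z ME]] pE]]]; exists (sigma w), (sigma v).
exists (fun f => (z * vsign k v) *: (Phi^T *m (tot (path_mx (assoc_rep Halpha f)
  c))^T *m Phi)).
  exact/path_fun_scale/path_fun_adjoint.
move=> f x y; rewrite pE ME;
  have := tot_mul_Phi_sq (path_mx (assoc_rep Halpha f) c).
move: (tot _) => P Psq.
have Pflip : (P *m Phi^T)^T = vsign k v *: (Phi^T *m P^T *m Phi *m Phi^T).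
  rewrite -(mulmxA _ Phi Phi^T)
    Phi_PhiT mulmx1 trmx_mul trmxK scalemxAr -linearZ /= -Psq.
  by rewrite -Phi_sq_tr !trmx_mul !trmxK !mulmxA PhiT_Phi mul1mx.
have -> : (z *: P *m Phi^T) y x = (z *: (P *m Phi^T)^T)
  x y by rewrite -scalemxAl !mxE.
by rewrite Pflip scalerA -scalemxAl.
Qed.

(** After reversing [p], the path of [q] and that of [p] are concatenated, if they
meet at [sigma v]; otherwise the result is 0. *)
Lemma bivector_glue v p q : bivector_family p -> bivector_family q ->
  bivector_family (fun f => glue B v (p f) (q f)).
Proof.
move=> /bivector_flip[v1 [w1 [M Mp pE]]] [v2 [w2 [N Np qE]]].
have gE f x y : glue B v (p f) (q f) x y =
    letter_sgn k y * \sum_(c | letter_tag c == sigma v)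
      M f x c * N f c (letter_dual Halpha y).
  rewrite /glue (reindex_inj (inv_inj (letter_dualK Halpha))) /= mulr_sumr.
  apply: eq_big => [c|c _];
    first by rewrite letter_tag_dual (can2_eq (@sigmaK _ _ _) (@sigmaK _ _ _)).
  rewrite pE qE !mul_PhiT letter_dualK; set s := letter_sgn k (_ _).
  have ss : s * s = 1 by exact: letter_sgnK.
  by rewrite -[RHS]mul1r -ss; ring.
have [/andP[/eqP e1 /eqP e2]|ne] := boolP ((v1 == sigma v) && (w2 == sigma v)).
  subst v1 w2; exists v2, w1; exists (fun f => M f *m N f);
    first exact: path_fun_mul Mp Np.
  move=> f x y; rewrite gE mul_PhiT mxE; congr (_ * _).
  rewrite big_mkcond; apply: eq_bigr => c _; case: ifP => // cN.
  have [->|/(path_fun_tag Mp)[_ cT]] := eqVneq (M f x c) 0; first by rewrite mul0r.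
  by rewrite cT eqxx in cN.
(* Any path serves for the zero bivector. *)
exists v2, w2; exists (fun f => 0 *: N f); first exact: path_fun_scale.
move=> f x y; rewrite gE scale0r mul0mx mxE big1 ?mulr0 // => c /eqP cT.
have [->|/(path_fun_tag Mp)[_ cv1]] := eqVneq (M f x c) 0; first by rewrite mul0r.
have [->|/(path_fun_tag Np)[cw2 _]] := eqVneq (N f c (letter_dual Halpha y)) 0;
  first by rewrite mulr0.
by rewrite -cv1 -cw2 cT eqxx in ne.
Qed.

Lemma bivector_close v p : bivector_family p ->
  in_subalg (trace_function (Q := Q) Halpha) (fun f => close B v (p f)).
Proof.
move=> [v1 [w1 [M [c [z ME]] pE]]].
have cE f : close B v (p f) = z * vsign k v * \sum_(x | letter_tag x == v)
  tot (path_mx (assoc_rep Halpha f) c) x x.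
  rewrite /close mulr_sumr; apply: eq_bigr => x /eqP xv.
  by rewrite pE mul_PhiT letter_dualK ME mxE -xv -(letter_sgn_dual k Halpha) /=;
    ring.
have [/andP[/eqP e1 /eqP e2]|ne] := boolP ((v1 == v) && (w1 == v)); last first.
  apply: in_subalg_ext (in_subalg_const _ 0) => f;
    rewrite cE big1 ?mulr0 // => x /eqP xv.
  apply/eqP; apply: contraNT ne => /tot_tag[<- <-]; by rewrite xv eqxx.
subst v1 w1.
apply: (@in_subalg_ext _ _ _ (fun f =>
  z * vsign k v * \tr (path_mx (assoc_rep Halpha f) c))).
  move=> f; rewrite cE -tot_tr; congr (_ * _); rewrite [RHS]big_mkcond;
    apply: eq_bigr => x _.
  by case: ifP => // xv; apply/eqP; apply: contraFT xv => /tot_tag[-> _].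
apply: in_subalgM; first exact: in_subalg_const.
by apply: in_subalg_gen; exists v, c.
Qed.

End Paths.

(** * The group in terms of the total form *)

Lemma contragredient_cast (k : fieldType) m n (e : m = n) (A : 'M[k]_m)
    (M : 'M[k]_n) :
  A^T *m castmx (esym e, esym e) M = 1%:M <-> A \in unitmx /\ M = castmx (e, e)
    (invmx A)^T.
Proof.
case: n / e M => M; rewrite !castmx_id; split=> [AM|[Au ->]]; last first.
  by rewrite -trmx_mul mulVmx // trmx1.
have [ATu Mu] := mulmx1_unit AM; split; first by rewrite -unitmx_tr.
by rewrite -[M]mul1mx -(mulVmx ATu) -mulmxA AM mulmx1 trmx_inv.
Qed.

Lemma castmx_conj (k : fieldType) m m' n n' (e1 : m = m') (e2 : n = n')
    (A : 'M[k]_m') (M : 'M[k]_(m, n)) (C : 'M[k]_n') :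
  A *m castmx (e1, e2) M *m invmx C =
  castmx (e1, e2) (castmx (esym e1, esym e1)
    A *m M *m invmx (castmx (esym e2, esym e2) C)).
Proof. by case: m' / e1 A; case: n' / e2 C => C A; rewrite !castmx_id. Qed.

Lemma contragredient_cast' (k : fieldType) m n (e : m = n) (A : 'M[k]_m)
    (M : 'M[k]_n) :
  A \in unitmx -> M = castmx (e, e) (invmx A)^T -> M^T *m castmx (e, e) A = 1%:M.
Proof.
by case: n / e M => M; rewrite !castmx_id => Au ->; rewrite trmxK mulVmx.
Qed.

Lemma castmx_gram (k : fieldType) m n p (e : m = n) (A : 'M[k]_(p, m))
    (M : 'M[k]_p) :
  castmx (e, e) (A^T *m M *m A) = (castmx (erefl, e) A)^T *m M *m castmx (erefl, e)
    A.
Proof. by case: n / e; rewrite !castmx_id. Qed.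

Section Group.
Variables (k : fieldType) (n1 n2 n3 : nat) (alpha : vertex n1 n2 n3 -> nat).
Hypothesis Halpha : admissible alpha.
Local Notation vertex := (vertex n1 n2 n3).
Local Notation B := (letter_basis k Halpha).
Local Notation Phi := (Phi B).
Local Notation form := (form_mx k alpha).

(** The component of [g] at [sigma v], as an endomorphism of k^(alpha v). *)
Definition dual_component (g : forall v : vertex, 'M[k]_(alpha v))
    v : 'M[k]_(alpha v) :=
  castmx (esym (admissible_sigma Halpha v), esym (admissible_sigma Halpha v))
    (g (sigma v)).

(** One condition covers the orthogonal, symplectic and contragredient cases: [g]
preserves the pairing of the spaces at [v] and [sigma v]. *)
Lemma in_GammaP (g : forall v : vertex, 'M[k]_(alpha v)) :
  in_Gamma Halpha g <-> forall v, (g v)^T *m form v *m dual_component g v = form v.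
Proof.
have eE l : Halpha.2 l = admissible_sigma Halpha (vu l) by exact: eq_irrelevance.
have eE' l : Halpha.2 l = esym (admissible_sigma Halpha (vustar l))
  by exact: eq_irrelevance.
rewrite /dual_component; split=> [[orth symp gl glstar]|H].
  case=> i /=; rewrite ?mulmx1.
  - by rewrite castmx_id; exact: orth.
  - by rewrite castmx_id; exact: symp.
  - by apply/contragredient_cast; rewrite glstar (eE i).
  - by rewrite -(eE' i); apply: contragredient_cast'.
have unit_cast l : g (vu l) \in unitmx /\ g (vustar l)
  = castmx (Halpha.2 l, Halpha.2 l) (invmx (g (vu l)))^T.
  by rewrite (eE l); apply/contragredient_cast; have := H (vu l); rewrite /= mulmx1.
split=> [i|j|l|l]; try by have [] := unit_cast l.
  by have := H (vs i); rewrite /= mulmx1 castmx_id.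
by have := H (vt j); rewrite /= castmx_id.
Qed.

Lemma Gamma_unit (g : forall v : vertex, 'M[k]_(alpha v))
    v : in_Gamma Halpha g -> g v \in unitmx.
Proof.
move/in_GammaP/(_ v); rewrite -mulmxA => gform.
have : (g v)^T *m (form v *m dual_component g v *m invmx (form v)) = 1%:M.
  by rewrite mulmxA gform mulmxV ?form_mx_unit.
by case/mulmx1_unit => + _; rewrite unitmx_tr.
Qed.

Lemma adjoint_conj (g : forall v : vertex, 'M[k]_(alpha v))
    v w (P : 'M[k]_(alpha w, alpha v)) : in_Gamma Halpha g ->
  adjoint Halpha (g w *m P *m invmx (g v)) = g (sigma v)
    *m adjoint Halpha P *m invmx (g (sigma w)).
Proof.
move=> gG; have gE := (in_GammaP g).1 gG;
  rewrite /adjoint castmx_conj -!/(dual_component g _).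
congr castmx; have gu u : g u \in unitmx by exact: Gamma_unit gG.
have fu u : form u \in unitmx by exact: form_mx_unit.
have cu u : dual_component g u \in unitmx.
  have : invmx (form u) *m (g u)^T *m form u *m dual_component g u = 1%:M.
    by rewrite -!mulmxA (mulmxA _ (form u)) gE mulVmx.
  by case/mulmx1_unit.
have right : (g w)^T *m form w = form w *m invmx (dual_component g w).
  by rewrite -[LHS](mulmxK (cu w)) gE.
have left : invmx (form v)
  *m (invmx (g v))^T = dual_component g v *m invmx (form v).
  have guT : (g v)^T \in unitmx by rewrite unitmx_tr.
  rewrite trmx_inv; apply: (can_inj (mulKmx (fu v))); rewrite mulKVmx //.
  apply: (can_inj (mulKmx guT)); rewrite mulmxV // !mulmxA gE mulmxV //.
by rewrite !trmx_mul !mulmxA left -!mulmxA right !mulmxA.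
Qed.

(** The component at [v] of an endomorphism of the total space. *)
Definition block (G : 'M[k]_ #|{: letter alpha}|) v : 'M[k]_(alpha v)
    := (incl k alpha v)^T *m G *m incl k alpha v.

Lemma mul_block (G : 'M[k]_ #|{: letter alpha}|)
    v : (forall x y, letter_tag x != letter_tag y -> G x y = 0) ->
  G *m incl k alpha v = incl k alpha v *m block G v.
Proof.
move=> Gd; apply/matrixP => x j; rewrite mul_incl /block.
have [w [i ->]] := letterP x; rewrite -[RHS]inclT_mul !mulmxA.
have [wv|wv] := eqVneq w v.
  by subst w; rewrite inclT_incl mul1mx mul_incl inclT_mul.
by rewrite Gd ?letter_tag_idx // inclT_incl0 // !mul0mx mxE.
Qed.

Lemma block_mul (G : 'M[k]_ #|{: letter alpha}|)
    v : (forall x y, letter_tag x != letter_tag y -> G x y = 0) ->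
  (incl k alpha v)^T *m G = block G v *m (incl k alpha v)^T.
Proof.
move=> Gd; apply/matrixP => i y; rewrite inclT_mul /block.
have [w [j ->]] := letterP y; rewrite -[RHS]mul_incl -!mulmxA.
have [wv|wv] := eqVneq v w.
  by subst w; rewrite inclT_incl mulmx1 inclT_mul mul_incl.
by rewrite Gd ?letter_tag_idx // inclT_incl0 // !mulmx0 mxE.
Qed.

Lemma block_form (G : 'M[k]_ #|{: letter alpha}|)
    v : preserves_form B G -> (block G v)^T *m form v *m dual_component (block G)
    v = form v.
Proof.
move=> [iso Gd].
rewrite /dual_component /block castmx_gram -/(dual_incl k Halpha v) -/(block G v).
have dual_incl_orth : (dual_incl k Halpha v)^T *m dual_incl k Halpha v = 1%:M.
  rewrite -[X in X *m _]mulmx1 /dual_incl -castmx_gram mulmx1 inclT_incl.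
  by case: (alpha v) / (esym _); rewrite castmx_id.
rewrite !mulmxA -[X in X *m _ *m _]mulmxA -inclT_Phi !mulmxA.
rewrite -[X in X *m _ *m _ *m _]trmx_mul -mul_block // trmx_mul.
transitivity ((incl k alpha v)^T *m (G^T *m Phi *m G) *m dual_incl k Halpha v).
  by rewrite !mulmxA.
by rewrite iso inclT_Phi -mulmxA dual_incl_orth mulmx1.
Qed.

Lemma block_in_Gamma (G : 'M[k]_ #|{: letter alpha}|)
    : preserves_form B G -> in_Gamma Halpha (block G).
Proof. by move=> iso; apply/in_GammaP => v; exact: block_form. Qed.

Lemma preserves_form_adj (G : 'M[k]_ #|{: letter alpha}|)
    v : preserves_form B G -> G^T *m Phi *m incl k alpha v = Phi *m incl k alpha v
    *m invmx (block G v).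
Proof.
move=> iso; have bu : block G v \in unitmx := Gamma_unit v (block_in_Gamma iso).
rewrite -[LHS](mulmxK bu) -[X in X *m invmx _]mulmxA -mul_block; last by case: iso.
by rewrite mulmxA iso.1.
Qed.

End Group.

(** * Trace functions are invariant polynomials *)

Section Easy.
Variables (k : fieldType) (n1 n2 n3 : nat) (Q : quiver (vertex n1 n2 n3))
    (alpha : vertex n1 n2 n3 -> nat).
Hypothesis Halpha : admissible alpha.
Local Notation rep := (qrep k Q alpha).
Local Notation poly_fun := (in_subalg (@coordinate_function k _ Q alpha)).

Lemma assoc_rep_poly (b : arrow (assoc_quiver Q)) i j :
  poly_fun (fun f => assoc_rep Halpha f b i j).
Proof.
case: b i j => a i j /=.
  by apply: in_subalg_gen; exists a, i, j.
pose c := invmx (form_mx k alpha (src a)); pose d := form_mx k alpha (tgt a).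
set i' := cast_ord (esym (admissible_sigma Halpha (src a))) i.
set j' := cast_ord (esym (admissible_sigma Halpha (tgt a))) j.
apply: (@in_subalg_ext _ _ _ (fun f : rep =>
  \sum_x (\sum_y c i' y * f a x y) * d x j')).
  move=> f; rewrite /adjoint castmxE mxE; apply: eq_bigr => x _; congr (_ * _).
  by rewrite mxE; apply: eq_bigr => y _; rewrite mxE.
apply: in_subalg_sum => x _; apply: in_subalgM (in_subalg_const _ _).
apply: in_subalg_sum => y _; apply: in_subalgM (in_subalg_const _ _) _.
by apply: in_subalg_gen; exists a, x, y.
Qed.

Lemma path_mx_poly v w (c : qpath (assoc_quiver Q) v w) i j :
  poly_fun (fun f => path_mx (assoc_rep Halpha f) c i j).
Proof.
elim: c i j => [a|{}v a c IH] i j /=; first exact: assoc_rep_poly.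
apply: (@in_subalg_ext _ _ _ (fun f : rep =>
  \sum_x assoc_rep Halpha f a i x * path_mx (assoc_rep Halpha f) c x j)).
  by move=> f; rewrite mxE.
by apply: in_subalg_sum => x _; apply: in_subalgM => //; exact: assoc_rep_poly.
Qed.

Lemma subalg_trace_poly (F : rep -> k) :
  in_subalg (trace_function Halpha) F -> polynomial_function F.
Proof.
apply: in_subalg_ind.
- by move=> F1 F2; exact: in_subalg_ext.
- by move=> c; exact: in_subalg_const.
- move=> G [v [c GE]]; apply: (@in_subalg_ext _ _ _ (fun f : rep =>
  \sum_i path_mx (assoc_rep Halpha f) c i i)).
    by move=> f; rewrite GE.
  by apply: in_subalg_sum => i _; exact: path_mx_poly.
- by move=> F1 F2; exact: in_subalgD.
by move=> F1 F2; exact: in_subalgM.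
Qed.

Lemma path_mx_act (g : forall v, 'M[k]_(alpha v)) (f : rep)
    v w (c : qpath (assoc_quiver Q) v w) : in_Gamma Halpha g ->
  path_mx (assoc_rep Halpha (qact g f)) c =
    g w *m path_mx (assoc_rep Halpha f) c *m invmx (g v).
Proof.
move=> gG; have arrowE (b : arrow (assoc_quiver Q)) : assoc_rep Halpha (qact g f) b
    = g (tgt b) *m assoc_rep Halpha f b *m invmx (g (src b)).
  by case: b => a //=; exact: adjoint_conj.
elim: c => [a|{}v a c IH] /=; first exact: arrowE.
by rewrite arrowE IH !mulmxA mulmxKV ?(Gamma_unit _ gG).
Qed.

Lemma subalg_trace_invariant (F : rep -> k) : in_subalg (trace_function Halpha)
    F -> Gamma_invariant Halpha F.
Proof.
move=> FS g gG; apply: (in_subalg_ind (C := fun F =>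
  forall f, F (qact g f) = F f)) FS.
- by move=> F1 F2 e inv f; rewrite -!e.
- by [].
- move=> G [v [c GE]] f; rewrite !GE path_mx_act // mxtrace_mulC mulmxA.
  by rewrite mulVmx ?mul1mx // (Gamma_unit _ gG).
- by move=> F1 F2 i1 i2 f; rewrite i1 i2.
by move=> F1 F2 i1 i2 f; rewrite i1 i2.
Qed.

End Easy.

(** * Invariant polynomials are generated by trace functions *)

Section Hard.
Variables (k : fieldType) (n1 n2 n3 : nat) (Q : quiver (vertex n1 n2 n3))
    (alpha : vertex n1 n2 n3 -> nat).
Hypothesis Halpha : admissible alpha.
Hypothesis char0 : [pchar k] =i pred0.
Local Notation rep := (qrep k Q alpha).
Local Notation L := 'I_#|{: letter alpha}|.
Local Notation B := (letter_basis k Halpha).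
Local Notation Phi := (Phi B).
Local Notation C := (arrow Q * L * L)%type.

Lemma polynomial_ext (F : rep -> k) (f f' : rep)
    : polynomial_function F -> (forall a, f a = f' a) -> F f = F f'.
Proof.
move=> FP e; apply: (in_subalg_ind (C := fun F => F f = F f')) FP => //.
- by move=> F1 F2 E; rewrite -!E.
- by move=> G [a [i [j GE]]]; rewrite !GE e.
- by move=> F1 F2 -> ->.
by move=> F1 F2 -> ->.
Qed.

Definition coord_mx (v : C -> k) (a : arrow Q)
    : 'M[k]_ #|{: letter alpha}| := \matrix_(x, y) v (a, x, y).

(** Representations and families of bivectors: [coords] embeds the former in the
latter, and [rep_of] is an equivariant retraction, along which invariant
polynomials extend. *)
Definition rep_of (v : C -> k) : rep := fun a =>
  (incl k alpha (tgt a))^T *m coord_mx v a *m Phi *m incl k alpha (src a).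

Definition coords (f : rep) : C -> k := fun c => (tot (f c.1.1) *m Phi^T) c.1.2 c.2.

Lemma rep_ofK f a : rep_of (coords f) a = f a.
Proof.
rewrite /rep_of (_ : coord_mx _ a = tot (f a) *m Phi^T);
  last by apply/matrixP => x y; rewrite mxE.
rewrite /tot -!mulmxA (mulmxA Phi^T)
  PhiT_Phi mul1mx inclT_incl mulmx1 mulmxA inclT_incl mul1mx.
by [].
Qed.

Definition act_coef (G : 'M[k]_ #|{: letter alpha}|) (c c' : C) : k :=
  (c.1.1 == c'.1.1)%:R * G c.1.2 c'.1.2 * G c.2 c'.2.

Lemma coord_mx_act G v a :
  coord_mx (mxact (act_coef G) v) a = G *m coord_mx v a *m G^T.
Proof.
apply/matrixP => x y; rewrite !mxE /mxact.
have sumC (h : C -> k) : \sum_c h c = \sum_b \sum_z \sum_z' h (b, z, z').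
  by rewrite pair_bigA pair_bigA; apply: eq_bigr => -[[]].
rewrite sumC.
rewrite (bigD1 a) //= [X in _ + X]big1 ?addr0 => [|b ba]; last first.
  by rewrite big1 // => z _; rewrite big1 // => z' _;
    rewrite /act_coef eq_sym (negbTE ba) !mul0r.
rewrite exchange_big /=; apply: eq_bigr => z' _; rewrite !mxE mulr_suml;
  apply: eq_bigr => z _.
by rewrite /act_coef /= eqxx mul1r !mxE mulrAC.
Qed.

Lemma rep_of_act G v a : preserves_form B G ->
  rep_of (mxact (act_coef G) v) a = qact (block G) (rep_of v) a.
Proof.
move=> GG; rewrite /rep_of /qact coord_mx_act !mulmxA block_mul; last by case: GG.
rewrite -!(mulmxA _ G^T) -!(mulmxA _ (G^T *m Phi)) (preserves_form_adj _ GG)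
  !mulmxA.
by [].
Qed.

Lemma rep_of_coord G : @coordinate_function k _ Q alpha G ->
  exists c x, forall v, G (rep_of v) = c * v x.
Proof.
move=> [a [i [j GE]]].
exists (letter_sgn k (letter_dual Halpha (letter_idx j))), (a, letter_idx i,
  letter_dual Halpha (letter_idx j)).
move=> v; rewrite GE /rep_of mul_incl -!mulmxA inclT_mul.
by rewrite -{1}(letter_dualK Halpha (letter_idx j)) mul_Phi mxE mulrC.
Qed.

(** For each word [a] of [d] arrows, the coefficients of [tau] form an invariant tensor
with two slots for each arrow, evaluated on the bivectors of these arrows. *)
Lemma form_eval_trace d (tau : {ffun 'I_d -> C} -> k) :
  (forall G, preserves_form B G -> forall u, tau u = \sum_(u' : {ffun 'I_d -> C})
    tau u' * \prod_r act_coef G (u' r) (u r)) ->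
  in_subalg (trace_function Halpha) (fun f : rep => form_eval tau (coords f)).
Proof.
move=> inv; pose I := ('I_d * bool)%type.
pose join (a : {ffun 'I_d -> arrow Q}) (w : {ffun I -> L}) : {ffun 'I_d -> C} :=
  [ffun r => (a r, w (r, false), w (r, true))].
pose arr (u : {ffun 'I_d -> C}) : {ffun 'I_d -> arrow Q} := [ffun r => (u r).1.1].
pose word (u : {ffun 'I_d -> C}) : {ffun I -> L} := [ffun i =>
  if i.2 then (u i.1).2 else (u i.1).1.2].
have joinK u : join (arr u) (word u) = u.
  by apply/ffunP => r; rewrite !ffunE /=; case: (u r) => -[].
have arrK a w : arr (join a w) = a by apply/ffunP => r; rewrite !ffunE.
have wordK a w : word (join a w) = w by apply/ffunP => -[r []]; rewrite !ffunE.
have sum_join (h : {ffun 'I_d -> C} -> k) : \sum_u h u = \sum_a \sum_w h (join a w).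
  rewrite pair_bigA /= (reindex (fun p => join p.1 p.2)) //=.
  by exists (fun u => (arr u, word u)) => [[a w]|u] _ /=;
    rewrite ?arrK ?wordK ?joinK.
have prod_slots (h : 'I_d -> bool -> k) : \prod_(i : I)
  h i.1 i.2 = \prod_r (h r false * h r true).
  by rewrite -(pair_bigA _ h); apply: eq_bigr => r _; rewrite big_bool mulrC.
have invT a : inv_tensor B setT (fun w => tau (join a w)).
  apply: inv_tensor_of_preserves_form => // G GG w; rewrite (inv G GG) sum_join.
  rewrite (bigD1 a) //= [X in _ + X]big1 ?addr0 => [|b ba]; last first.
    rewrite big1 // => w' _.
    have [r br] := ffun_neq ba.
    by rewrite (bigD1 r) //= /act_coef !ffunE /= (negbTE br) !mul0r mulr0.
  apply: eq_bigr => w' _; congr (_ * _).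
  transitivity (\prod_r (G (w' (r, false)) (w (r, false)) * G (w' (r, true))
    (w (r, true)))).
    by apply: eq_bigr => r _; rewrite /act_coef !ffunE /= eqxx mul1r.
  by rewrite -(prod_slots (fun r b => G (w' (r, b)) (w (r, b))));
    apply: eq_bigr => -[].
have entry b : bivector_family Halpha (fun (f : rep) x y => coords f (b, x, y)).
  exists (src b), (tgt b), (fun f => tot (f b)) => //.
  by exists (path_arrow (Q := assoc_quiver Q) (inl b)), 1 => f; rewrite scale1r.
pose l a := [seq ((r, false), (r, true), fun (f : rep) (x y : L) =>
  coords f (a r, x, y)) | r <- enum 'I_d].
have slotsE a : slots (l a) = [seq (r, b) | r <- enum 'I_d, b <- [:: false; true]].
  by rewrite /slots /l -map_comp.
have slots_uniq a : uniq (slots (l a)).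
  by rewrite slotsE allpairs_uniq ?enum_uniq // => -[? ?] [? ?] _ _ [-> ->].
have slots_full a i : i \in slots (l a).
  by rewrite slotsE; case: i => r b; apply/allpairsP; exists (r, b); split=> //=;
    rewrite ?mem_enum //; case: b.
have l_in a : all_in (@bivector_family k _ _ _ Q _ Halpha) (l a).
  by rewrite /l; elim: (enum _) => //= r s IH; split.
apply: (@in_subalg_ext _ _ _ (fun f : rep => \sum_a \sum_w tau (join a w) *
    \prod_r coords f (a r, w (r, false), w (r, true)))).
  move=> f; rewrite /form_eval /tensor_eval sum_join; apply: eq_bigr => a _;
    apply: eq_bigr => w _.
  by congr (_ * _); apply: eq_bigr => r _; rewrite ffunE.
apply: in_subalg_sum => a _.
(* If the total space is 0 there may be no word to start [ev] from. *)
have [w0 _|no_word] := pickP (predT : pred {ffun I -> L}); last first.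
  by apply: in_subalg_ext (in_subalg_const _ 0) => f; rewrite big1 // => w;
    have := no_word w.
apply: (@in_subalg_ext _ _ _ (fun f : rep => ev (inst f (l a)) (fun w =>
  tau (join a w)) w0)).
  move=> f; rewrite ev_words ?slots_inst //; apply: eq_big => [w|w _].
    by apply/forallP => i; rewrite slots_full.
  by congr (_ * _); rewrite /inst /l -map_comp big_map big_enum.
apply: (@ev_in_subalg _ _ _ _ B _ (@bivector_family k _ _ _ Q _ Halpha)) => //.
- exact: bivector_flip.
- by move=> v p q; exact: bivector_glue.
- by move=> v p; exact: bivector_close.
by rewrite (_ : [set i in slots (l a)] = setT) //; apply/setP => i;
  rewrite !inE slots_full.
Qed.

Lemma invariant_in_trace_subalg (F : rep -> k) :
  polynomial_function F -> Gamma_invariant Halpha F ->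
  in_subalg (trace_function Halpha) F.
Proof.
move=> FP inv; have [l lE] := in_subalg_monomial rep_of_coord FP.
have linv G : preserves_form B G -> forall v, monomial_sum l (mxact (act_coef G) v)
  = monomial_sum l v.
  move=> GG v; rewrite -!lE (polynomial_ext FP (fun a => rep_of_act v a GG)).
  by rewrite inv //; exact: block_in_Gamma.
have [N _ NE] := monomial_sum_parts char0 l.
apply: (@in_subalg_ext _ _ _ (fun f : rep =>
  \sum_(d < N) form_eval (sym_tensor (@coef_tensor k C l d)) (coords f))).
  by move=> f; rewrite -NE -lE (polynomial_ext FP (rep_ofK f)).
apply: in_subalg_sum => d _; apply: form_eval_trace => G GG u.
exact: (coef_tensor_invariant char0 (linv G GG)).
Qed.

End Hard.

Theorem theorem2p3p3 (k : closedFieldType) (chark0 : [pchar k] =i pred0)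
    (n1 n2 n3 : nat) (Q : quiver (vertex n1 n2 n3))
    (alpha : vertex n1 n2 n3 -> nat) (Halpha : admissible alpha)
    (F : qrep k Q alpha -> k) :
  polynomial_function F /\ Gamma_invariant Halpha F <->
  in_subalg (trace_function (Q := Q) Halpha) F.
Proof.
split=> [[FP inv]|FS]; first exact: invariant_in_trace_subalg.
by split; [exact: subalg_trace_poly FS | exact: subalg_trace_invariant].
Qed.
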